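(* Let $\mathbb{K}$ be an algebraically closed field of characteristic $0$. Let $f\in\mathbb{K}[X,Y,Z]$ be homogeneous of degree $d\ge1$, and suppose $f=f_1^{e_1}\cdots f_r^{e_r}$ where the $f_i$ are pairwise non-proportional irreducible homogeneous polynomials of degrees $d_i$. Then $$\dim_{\mathbb{K}}\ker\mathcal{R}(f)=r-2+\binom{2+\sum_{i=1}^r d_i(e_i-1)}{2}.$$ In particular, $f$ is irreducible if and only if $\dim_{\mathbb{K}}\ker\mathcal{R}(f)=0$.
   Context: $\mathbb{K}[X,Y,Z]_n$ denotes the homogeneous polynomials of degree $n$. Let $E=\{(G,H)\in\mathbb{K}[X,Y,Z]_{d-1}\times\mathbb{K}[X,Y,Z]_{d-1}:\ Z\text{ divides }XG+YH\}$. The $\mathbb{K}$-linear map $\mathcal{R}(f):E\to\mathbb{K}[X,Y,Z]_{2d-3}$ is $(G,H)\mapsto \frac1Z\big(f\,\partial_YG-G\,\partial_Yf-f\,\partial_XH+H\,\partial_Xf\big)=\frac1Z f^2\big(\partial_Y(G/f)-\partial_X(H/f)\big)$ (the division by $Z$ is exact on $E$). *)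

(* Defs.v *)
From HB Require Import structures.
From mathcomp Require Import all_boot all_order all_algebra.
From mathcomp Require Import mpoly.
Set Implicit Arguments. Unset Strict Implicit. Unset Printing Implicit Defensive.
Import Order.TTheory GRing.Theory.
Local Open Scope ring_scope.

Section Defs.
Variable K : fieldType.
Local Notation P := {mpoly K[3]}.

Definition iX : 'I_3 := @Ordinal 3 0 isT.
Definition iY : 'I_3 := @Ordinal 3 1 isT.
Definition iZ : 'I_3 := @Ordinal 3 2 isT.

Definition varX : P := 'X_iX.
Definition varY : P := 'X_iY.
Definition varZ : P := 'X_iZ.

Definition mirreducible (p : P) : Prop :=
  p != 0 /\ p \isn't a GRing.unit /\
  forall a b : P, p = a * b -> a \is a GRing.unit \/ b \is a GRing.unit.

Definition inE (d : nat) (v : P * P) : Prop :=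
  v.1 \is (d.-1).-homog /\ v.2 \is (d.-1).-homog /\
  exists Q : P, varX * v.1 + varY * v.2 = varZ * Q.

Definition Rnum (f G H : P) : P :=
  f * G^`M(iY) - G * f^`M(iY) - f * H^`M(iX) + H * f^`M(iX).

(* the value of R(f) at v is Q, where Rnum = Z * Q (exact division on E) *)
Definition Rval (f : P) (v : P * P) (Q : P) : Prop :=
  Rnum f v.1 v.2 = varZ * Q.

Definition kerR (f : P) (d : nat) (v : P * P) : Prop :=
  inE d v /\ exists Q, Rval f v Q /\ Q = 0.

Definition lincomb (n : nat) (c : 'I_n -> K) (b : 'I_n -> P * P) : P * P :=
  (\sum_(i < n) c i *: (b i).1, \sum_(i < n) c i *: (b i).2).

Definition has_dim (S : P * P -> Prop) (n : nat) : Prop :=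
  exists b : 'I_n -> P * P,
    (forall i, S (b i)) /\
    (forall c : 'I_n -> K, lincomb c b = (0, 0) -> forall i, c i = 0) /\
    (forall v, S v -> exists c : 'I_n -> K, v = lincomb c b).
End Defs.

(* Main.v *)
(* Writing X G + Y H + Z I = 0, an element (G, H) of the kernel of R(f) is the same thing as a
   closed rational 1-form w = (G dX + H dY + I dZ) / f of degree 0 killed by the Euler field.
   Over an algebraically closed field of characteristic 0 every closed rational 1-form is
   sum_k c_k dq_k / q_k + du: Hermite reduction with respect to one variable at a time lowers
   the poles until only constants of integration are left, the residue along a prime being
   constant because it is algebraic and killed by all derivations.
   Comparing pole orders prime by prime, and degrees at infinity, w has the form
   sum_i mu_i df_i / f_i + d(h / g) with g = prod_i f_i^(e_i - 1), where h may be taken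
   homogeneous of degree deg g, and the Euler condition is sum_i mu_i d_i = 0. The pair (mu, h)
   is unique up to adding a multiple of g to h, whence the dimension
   (r - 1) + (binomial(2 + deg g, 2) - 1). *)
Require Import Defs.
From HB Require Import structures.
From mathcomp Require Import all_boot all_order all_algebra.
From mathcomp Require Import mpoly.
From mathcomp Require Import ring zify generic_quotient.
From Stdlib Require Import Classical.
Set Implicit Arguments. Unset Strict Implicit. Unset Printing Implicit Defensive.
Import GRing.Theory.
Local Open Scope ring_scope.


(** * Unique factorization in polynomial rings *)

(** Everything takes place in one field L = Frac K[X,Y,Z] with its three commuting derivations.
    K[X,Y,Z] is read as K[X][Y][Z], so that removing a variable is a descent from A[x] to A, where A
    is factorial but in general not a field. Euclid's algorithm in A[x] works only up to a nonzero
    element of A; this is why the reduction steps return a factor c in A, harmless for the current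
    variable and part of the denominator to be treated with the next one. Orders along a prime p are
    handled without a valuation: a pole of order at most n means that p^n x lies in the localization
    at p. The obstacle is the residue. It lives in the residue field of p, to which the derivations
    D_j need not descend. The combinations D_0(p) D_j - D_j(p) D_0, where D_0 is the derivation in
    the current variable, kill p and do descend; closedness of the form says that they kill the
    residue. The q_k produced by integration are arbitrary. They are not matched with the f_i: only
    the total residue of the logarithmic part along each prime enters. *)

Section Divisibility.
Variable B : idomainType.
Implicit Types a b c p q : B.

Definition divides a b := exists c, b = a * c.

Definition prime_elt p :=
  [/\ p != 0, p \isn't a GRing.unit &
      forall a b, divides p (a * b) -> divides p a \/ divides p b].

(** Asking for prime factors, not merely irreducible ones, builds the uniqueness of factorizations
    into the definition. *)
Definition factorial_ring := forall b, b != 0 ->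
  exists u (s : seq B), [/\ u \is a GRing.unit,
    forall q, q \in s -> prime_elt q & b = u * \prod_(q <- s) q].

Lemma divides_refl a : divides a a.
Proof. by exists 1; rewrite mulr1. Qed.

Lemma divides0 a : divides a 0.
Proof. by exists 0; rewrite mulr0. Qed.

Lemma divides_mulr a b c : divides a b -> divides a (b * c).
Proof. by case=> t ->; exists (t * c); rewrite mulrA. Qed.

Lemma divides_mull a b c : divides a b -> divides a (c * b).
Proof. by rewrite mulrC; exact: divides_mulr. Qed.

Lemma divides_add a b c : divides a b -> divides a c -> divides a (b + c).
Proof. by move=> [s ->] [t ->]; exists (s + t); rewrite mulrDr. Qed.

Lemma divides_opp a b : divides a b -> divides a (- b).
Proof. by move=> [s ->]; exists (- s); rewrite mulrN. Qed.

Lemma divides_trans a b c : divides a b -> divides b c -> divides a c.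
Proof. by move=> [s ->] [t ->]; exists (s * t); rewrite mulrA. Qed.

Lemma prime_elt_ndiv_unit p a : prime_elt p -> a \is a GRing.unit -> ~ divides p a.
Proof.
move=> [_ /negP pu _] ua [c ac]; apply: pu.
by move: ua; rewrite ac unitrM => /andP[].
Qed.

Lemma prime_elt_ndivM p a b :
  prime_elt p -> ~ divides p a -> ~ divides p b -> ~ divides p (a * b).
Proof. by move=> [_ _ pp] na nb /pp[]. Qed.

Lemma prime_elt_ndivX p a n : prime_elt p -> ~ divides p a -> ~ divides p (a ^+ n).
Proof.
move=> pp na; elim: n => [|n IHn]; last by rewrite exprS; exact: prime_elt_ndivM.
by rewrite expr0; apply: prime_elt_ndiv_unit => //; rewrite unitr1.
Qed.

Lemma prime_elt_irreducible p a b : prime_elt p -> p = a * b ->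
  a \is a GRing.unit \/ b \is a GRing.unit.
Proof.
move=> [p0 _ pp] pab.
have a0 : a != 0 by apply: contraNneq p0 => a0; rewrite pab a0 mul0r.
have b0 : b != 0 by apply: contraNneq p0 => b0; rewrite pab b0 mulr0.
have /pp[[c ac]|[c bc]] : divides p (a * b) by rewrite -pab; exact: divides_refl.
- right; apply/unitrPr; exists c; apply: (mulfI a0).
  by rewrite mulr1 mulrA -pab -ac.
- left; apply/unitrPr; exists c; apply: (mulfI b0).
  by rewrite mulr1 mulrCA mulrA -pab -bc.
Qed.

Lemma prime_elt_sym p q : prime_elt p -> prime_elt q -> divides p q -> divides q p.
Proof.
move=> pp pq [c qpc]; case: (prime_elt_irreducible pq qpc) => [up|uc].
  by case: pp => _; rewrite up.
by exists c^-1; rewrite qpc mulrK.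
Qed.

Lemma prime_elt_mul_unit p u : prime_elt p -> u \is a GRing.unit -> prime_elt (p * u).
Proof.
move=> [p0 pu pp] uu; split.
- by rewrite mulf_neq0 //; apply: contraTneq uu => ->; rewrite unitr0.
- by rewrite unitrMl.
- have pP a : divides (p * u) a <-> divides p a.
    split=> -[c ->]; first by rewrite -mulrA; exists (u * c).
    by exists (u^-1 * c); rewrite -mulrA mulVKr.
  by move=> a b /pP /pp[] /pP; [left|right].
Qed.

Lemma factorial_irreducible_prime b : factorial_ring -> b != 0 ->
  b \isn't a GRing.unit ->
  (forall x y, b = x * y -> x \is a GRing.unit \/ y \is a GRing.unit) ->
  prime_elt b.
Proof.
move=> fB b0 nub irr; have [u [[|q s] [uu ps bE]]] := fB b b0.
  by move: nub; rewrite bE big_nil mulr1 uu.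
have pq : prime_elt q by apply: ps; rewrite mem_head.
move: bE; rewrite big_cons mulrCA => bE; rewrite bE.
apply: prime_elt_mul_unit => //.
by case: (irr _ _ bE) => // uq; case: pq => _; rewrite uq.
Qed.

(** The prime factors associated to [p] are collected in p^e; the unit and the other factors form
    [g]. This stands in for a p-adic valuation. *)
Lemma factorial_prime_power p b : factorial_ring -> prime_elt p -> b != 0 ->
  exists e g, ~ divides p g /\ b = p ^+ e * g.
Proof.
move=> fB pp b0; have [u [s [uu ps ->]]] := fB b b0.
have {b b0} : exists e g, ~ divides p g /\ \prod_(q <- s) q = p ^+ e * g.
  elim: s ps => [|q s IHs] ps.
    exists 0%N, 1; rewrite big_nil expr0 mulr1; split=> //.
    by apply: prime_elt_ndiv_unit => //; exact: unitr1.
  have [e [g [pg Es]]] : exists e g, ~ divides p g /\ \prod_(q <- s) q = p ^+ e * g.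
    by apply: IHs => t ts; apply: ps; rewrite inE ts orbT.
  have pq : prime_elt q by apply: ps; rewrite mem_head.
  rewrite big_cons Es; case: (classic (divides p q)) => [[t qE]|npq].
    have ut : t \is a GRing.unit.
      by case: (prime_elt_irreducible pq qE) => // up; case: pp => _; rewrite up.
    exists e.+1, (t * g); split; last by rewrite qE exprS -!mulrA (mulrCA t).
    by apply: prime_elt_ndivM => //; exact: prime_elt_ndiv_unit.
  by exists e, (q * g); split; [exact: prime_elt_ndivM|rewrite mulrCA].
move=> [e [g [pg ->]]]; exists e, (u * g); split; last by rewrite mulrCA.
by apply: prime_elt_ndivM => //; exact: prime_elt_ndiv_unit.
Qed.

End Divisibility.

Lemma factorial_field (F : fieldType) : factorial_ring F.
Proof.
move=> b b0; exists b, [::]; split=> //; first by rewrite unitfE.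
by rewrite big_nil mulr1.
Qed.

(** The inverse [psi] is a bare function, as a choice of preimages provides it; its multiplicativity
    follows from the injectivity of [phi]. *)
Lemma factorial_transfer (A B : idomainType) (phi : {rmorphism A -> B}) (psi : B -> A) :
  cancel phi psi -> cancel psi phi -> factorial_ring A -> factorial_ring B.
Proof.
move=> phiK psiK fA b b0.
have psiM x y : psi (x * y) = psi x * psi y.
  by apply: (can_inj phiK); rewrite rmorphM !psiK.
have [|u [s [uu ps bE]]] := fA (psi b).
  by apply: contraNneq b0 => pb; rewrite -(psiK b) pb rmorph0.
have primephi q : prime_elt q -> prime_elt (phi q).
  move=> [q0 nu pq]; split.
  - by apply: contraNneq q0 => pq0; apply/eqP/(can_inj phiK); rewrite pq0 rmorph0.
  - apply: contraNN nu => /unitrP[y [/(congr1 psi) y1 _]].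
    rewrite psiM phiK -(rmorph1 phi) phiK in y1.
    by apply/unitrPr; exists (psi y); rewrite mulrC.
  - move=> x y [c /(congr1 psi)]; rewrite !psiM phiK => E.
    have /pq : divides q (psi x * psi y) by exists (psi c).
    by case=> -[t /(congr1 phi)]; rewrite rmorphM psiK => ->; [left|right]; exists (phi t).
exists (phi u), (map phi s); split.
- exact: rmorph_unit.
- by move=> _ /mapP[q qs ->]; apply/primephi/ps.
- by rewrite -(psiK b) bE rmorphM rmorph_prod big_map.
Qed.

(** * Gauss's lemma: polynomials over a factorial ring form a factorial ring *)

Section GaussLemma.
Variable A : idomainType.
Implicit Types (P Q T : {poly A}) (p c : A).

Lemma divides_polyC0 p P : divides p%:P P -> divides p P`_0.
Proof. by move=> [Q ->]; exists (Q`_0); rewrite coefCM. Qed.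

Lemma poly_shift P : exists Q, P = (P`_0)%:P + 'X * Q /\ (P != 0 -> (size Q < size P)%N).
Proof.
elim/poly_ind: P => [|P c _]; first by exists 0; rewrite coef0 mulr0 addr0 eqxx.
exists P; split.
  by rewrite coefD coefMX coefC !eqxx add0r addrC mulrC.
rewrite size_MXaddC; case: ifP => // /andP[/eqP -> /eqP ->].
by rewrite mul0r add0r eqxx.
Qed.

Lemma divides_polyC_shift p P Q : divides p%:P (P`_0)%:P -> P = (P`_0)%:P + 'X * Q ->
  divides p%:P Q -> divides p%:P P.
Proof. by move=> d0 -> dQ; apply: divides_add => //; exact: divides_mull. Qed.

Lemma divides_polyCX p P : divides p%:P ('X * P) -> divides p%:P P.
Proof.
move=> [Q]; have [T [QE _]] := poly_shift Q; rewrite QE mulrDr mulrCA -polyCM => E.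
have pQ0 : p * Q`_0 = 0.
  have := congr1 (fun P => P`_0) E.
  by rewrite /= coefD coefC !coefXM /= addr0.
rewrite pQ0 polyC0 add0r in E; exists T; by apply: mulfI E; rewrite polyX_eq0.
Qed.

(** By induction on the total size: [p] divides the product of the constant terms, hence one of
    them. Removing that term and cancelling the variable from its factor leaves a shorter product
    still divisible by [p]. *)
Lemma prime_polyC p : prime_elt p -> prime_elt p%:P.
Proof.
move=> [p0 pu pp]; split; rewrite ?polyC_eq0 //.
  by rewrite poly_unitE coefC eqxx (negPf pu) andbF.
move=> P Q; move: {2}(_ + _)%N (leqnn (size P + size Q)) => n.
elim: n P Q => [|n IHn] P Q.
  by rewrite leqn0 addn_eq0 size_poly_eq0 => /andP[/eqP -> _] _; left; exact: divides0.
have divC a : divides p a -> divides p%:P a%:P.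
  by move=> [c ->]; exists c%:P; rewrite polyCM.
have aux (R S : {poly A}) : (size R + size S <= n.+1)%N -> divides p R`_0 -> divides p%:P (R * S) ->
    divides p%:P R \/ divides p%:P S.
  move=> le pR0 dRS; have [->|R0] := eqVneq R 0; first by left; exact: divides0.
  have [T [RE /(_ R0) ltT]] := poly_shift R.
  have dTS : divides p%:P (T * S).
    apply: divides_polyCX; rewrite mulrA.
    have -> : 'X * T * S = R * S + - ((R`_0)%:P * S).
      by rewrite [in R * S]RE mulrDl addrAC subrr add0r.
    apply: divides_add => //; apply/divides_opp/divides_mulr; exact: divC.
  case: (IHn T S _ dTS) => [|dT|dS]; last by right.
    by rewrite -ltnS (leq_trans _ le) // ltn_add2r.
  by left; apply: divides_polyC_shift RE dT; exact: divC.
move=> le d; have /pp[d0|d0] : divides p (P`_0 * Q`_0).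
- by have := divides_polyC0 d; rewrite coef0M.
- exact: aux.
- by rewrite mulrC addnC in d le; case: (aux _ _ le d0 d); [right|left].
Qed.

Hypothesis fA : factorial_ring A.

(** The prime factors of [c] are cancelled one by one, each dividing [Q] or [T] by Gauss's lemma.
    Thus a factorization over the fraction field yields one over A with the same degrees. *)
Lemma poly_clear_constant c P Q T : c != 0 -> c%:P * P = Q * T ->
  exists Q' T', [/\ P = Q' * T', size Q' = size Q & size T' = size T].
Proof.
move=> /fA[u [s [uu]]].
elim: s c P Q T => [|q s IHs] c P Q T ps -> E.
  exists (u^-1%:P * Q), T; rewrite big_nil mulr1 in E.
  rewrite -mulrA -E mulrA -polyCM mulVr // mul1r; split=> //.
  by rewrite mul_polyC size_scale // invr_eq0; apply: contraTneq uu => ->; rewrite unitr0.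
rewrite big_cons mulrCA polyCM -mulrA in E.
have pq : prime_elt q by apply: ps; rewrite mem_head.
have q0 : q%:P != 0 by rewrite polyC_eq0; case: pq.
have [_ _ pP] := prime_polyC pq.
have szq R : size (q%:P * R) = size R.
  by rewrite mul_polyC size_scale // -polyC_eq0.
have ps' t : t \in s -> prime_elt t by move=> ts; apply: ps; rewrite inE ts orbT.
have /pP[[Q1 QE]|[T1 TE]] : divides q%:P (Q * T) by rewrite -E; exists ((u * \prod_(j <- s) j)%:P * P).
- move: E; rewrite QE -mulrA => /(mulfI q0) E.
  by have [Q' [T' [-> sQ sT]]] := IHs _ _ _ _ ps' erefl E; exists Q', T'; rewrite szq.
- move: E; rewrite TE (mulrCA Q) => /(mulfI q0) E.
  by have [Q' [T' [-> sQ sT]]] := IHs _ _ _ _ ps' erefl E; exists Q', T'; rewrite szq.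
Qed.

Definition primitive P := forall p, prime_elt p -> ~ divides p%:P P.

Lemma primitive_clear_constant c P Q T : primitive P -> c != 0 ->
  c%:P * T = Q * P -> divides P T.
Proof.
move=> primP /fA[u [s [uu]]].
elim: s c Q T => [|q s IHs] c Q T ps -> E.
  exists (u^-1%:P * Q); rewrite big_nil mulr1 in E.
  by rewrite mulrCA (mulrC P) -E mulrA -polyCM mulVr // mul1r.
rewrite big_cons mulrCA polyCM -mulrA in E.
have pq : prime_elt q by apply: ps; rewrite mem_head.
have q0 : q%:P != 0 by rewrite polyC_eq0; case: pq.
have [_ _ pP] := prime_polyC pq.
have /pP[[Q1 QE]|/(primP _ pq)//] : divides q%:P (Q * P).
  by rewrite -E; exists ((u * \prod_(j <- s) j)%:P * T).
move: E; rewrite QE -mulrA => /(mulfI q0) E.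
by apply: (IHs _ _ _ _ erefl E) => t ts; apply: ps; rewrite inE ts orbT.
Qed.

(** Over the fraction field the gcd of [P] and [a] is, up to constants, [P] or 1. Accordingly [P]
    divides a constant multiple of [a] or of [b], and primitivity removes the constant. *)
Lemma primitive_irreducible_prime P : primitive P -> (1 < size P)%N ->
  (forall Q T, P = Q * T -> size Q = 1%N \/ size T = 1%N) -> prime_elt P.
Proof.
move=> primP szP irr; have P0 : P != 0 by rewrite -size_poly_gt0 ltnW.
split=> //.
  by rewrite poly_unitE gtn_eqF.
move=> a b [c abE].
have [[k t] /= k0 Et] := Pdiv.Idomain.dvdpP _ _ (dvdp_gcdl P a).
have [Q [T [PE szQ szT]]] := poly_clear_constant k0 (etrans (mul_polyC _ _) Et).
have [szt|szg] := irr _ _ PE.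
- left; have [[k1 t1] /= k10 Et1] := Pdiv.Idomain.dvdpP _ _ (dvdp_gcdr P a).
  rewrite szQ in szt; have /size_poly1P[l l0 tE] : size t == 1%N by rewrite szt.
  apply: (@primitive_clear_constant (l * k1) _ (k *: t1)) => //; first by rewrite mulf_neq0.
  by rewrite polyCM -mulrA mul_polyC mul_polyC Et1 -scalerAl (scalerAr k) Et tE mul_polyC scalerAr.
- right; have cop : coprimep P a by rewrite /coprimep -szT szg.
  have : P %| a * b by rewrite abE dvdp_mulr.
  rewrite Gauss_dvdpr // => /Pdiv.Idomain.dvdpP[[k1 t1] /= k10 Et1].
  by apply: (@primitive_clear_constant k1 _ t1) => //; rewrite mul_polyC.
Qed.

Lemma primitive_factor P Q : primitive P -> divides Q P -> primitive Q.
Proof. by move=> primP QP p pp pQ; apply: (primP p pp); exact: divides_trans QP. Qed.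

Lemma primitive_prime_factorization P : P != 0 -> primitive P ->
  exists u (s : seq {poly A}), [/\ u \is a GRing.unit,
    forall q, q \in s -> prime_elt q & P = u * \prod_(q <- s) q].
Proof.
have [n] := ubnP (size P); elim: n P => // n IHn P leP P0 primP.
have [szP|szP] := leqP (size P) 1.
  have [c Pc] : exists c, P = c%:P by exists P`_0; exact: size1_polyC.
  have c0 : c != 0 by rewrite -polyC_eq0 -Pc.
  have [u [[|q s] [uu ps cE]]] := fA c0.
    rewrite big_nil mulr1 in cE; exists P, [::]; split=> //; last by rewrite big_nil mulr1.
    by rewrite Pc poly_unitE size_polyC c0 coefC eqxx cE.
  have pq : prime_elt q by apply: ps; rewrite mem_head.
  case: (primP q pq); rewrite Pc cE big_cons mulrCA polyCM.
  exact/divides_mulr/divides_refl.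
case: (classic (forall Q T, P = Q * T -> size Q = 1%N \/ size T = 1%N)) => [irr|].
  exists 1, [:: P]; split; rewrite ?unitr1 //; last by rewrite big_seq1 mul1r.
  by move=> q; rewrite inE => /eqP ->; exact: primitive_irreducible_prime.
move=> /not_all_ex_not[Q] /not_all_ex_not[T] H.
have PE : P = Q * T by apply: NNPP => nP; apply: H => /nP.
have sQ : size Q != 1%N by apply/eqP=> sQ; apply: H; left.
have sT : size T != 1%N by apply/eqP=> sT; apply: H; right.
have Q0 : Q != 0 by apply: contraNneq P0 => Q0; rewrite PE Q0 mul0r.
have T0 : T != 0 by apply: contraNneq P0 => T0; rewrite PE T0 mulr0.
have szE := size_mul Q0 T0; rewrite -PE in szE.
have sQ1 : (1 < size Q)%N by rewrite ltn_neqAle eq_sym sQ size_poly_gt0.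
have sT1 : (1 < size T)%N by rewrite ltn_neqAle eq_sym sT size_poly_gt0.
have [||u [s [uu ps QE]]] := IHn Q _ Q0.
- by lia.
- by apply: primitive_factor primP _; exists T.
have [||u' [s' [uu' ps' TE]]] := IHn T _ T0.
- by lia.
- by apply: primitive_factor primP _; exists Q; rewrite mulrC.
exists (u * u'), (s ++ s'); split.
- by rewrite unitrM uu.
- by move=> q; rewrite mem_cat => /orP[/ps|/ps'].
- by rewrite big_cat PE {1}QE {1}TE mulrACA.
Qed.

(** A prime of A dividing [P] divides its leading coefficient, so only the prime factors of the
    latter need testing. In the induction [w] collects those found not to divide [P], under the
    invariant that no prime dividing [P] divides [w]. *)
Lemma poly_content P : P != 0 -> exists c Q, P = c%:P * Q /\ primitive Q.
Proof.
move=> P0; have lP : lead_coef P != 0 by rewrite lead_coef_eq0.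
have [u [s [uu ps lE]]] := fA lP.
have : forall p, prime_elt p -> divides p%:P P -> ~ divides p u.
  by move=> p pp _; exact: prime_elt_ndiv_unit.
elim: s {uu} u P {lP} P0 ps lE => [|q s IHs] w P P0 ps lE npw.
  exists 1, P; rewrite mul1r; split=> // p pp [Q PE].
  apply: (npw p pp); first by exists Q.
  by rewrite big_nil mulr1 in lE; rewrite -lE PE lead_coefM lead_coefC; exists (lead_coef Q).
have pq : prime_elt q by apply: ps; rewrite mem_head.
have ps' t : t \in s -> prime_elt t by move=> ts; apply: ps; rewrite inE ts orbT.
rewrite big_cons in lE.
case: (classic (divides q%:P P)) => [[Q PE]|nqP].
  have Q0 : Q != 0 by apply: contraNneq P0 => Q0; rewrite PE Q0 mulr0.
  have q0 : q != 0 by case: pq.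
  have [||c [Q' [QE primQ']]] := IHs w Q Q0 ps'.
  - by apply: (mulfI q0); rewrite mulrCA -lE PE lead_coefM lead_coefC.
  - by move=> p pp pQ; apply: npw => //; rewrite PE; exact: divides_mull.
  by exists (q * c), Q'; rewrite PE QE polyCM mulrA.
apply: (IHs (w * q) P P0 ps'); first by rewrite -mulrA.
move=> p pp pP; apply: prime_elt_ndivM => //; first exact: npw.
move=> pdq; apply: nqP; have [t pE] := prime_elt_sym pp pq pdq.
by apply: divides_trans pP; rewrite pE polyCM; exact/divides_mulr/divides_refl.
Qed.

Theorem factorial_poly : factorial_ring {poly A}.
Proof.
move=> P P0; have [c [Q [PE primQ]]] := poly_content P0.
have Q0 : Q != 0 by apply: contraNneq P0 => Q0; rewrite PE Q0 mulr0.
have c0 : c != 0 by apply: contraNneq P0 => c0; rewrite PE c0 mul0r.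
have [u [s [uu ps QE]]] := primitive_prime_factorization Q0 primQ.
have [v [t [uv pt cE]]] := fA c0.
exists (v%:P * u), (map polyC t ++ s); split.
- have v0 : v != 0 by apply: contraTneq uv => ->; rewrite unitr0.
  by rewrite unitrM uu andbT poly_unitE coefC eqxx uv size_polyC v0.
- move=> q; rewrite mem_cat => /orP[/mapP[x xt ->]|/ps //].
  exact/prime_polyC/pt.
- by rewrite big_cat big_map PE cE {1}QE polyCM rmorph_prod mulrACA.
Qed.

End GaussLemma.

(** * Derivations and pole orders *)

Definition derivation (L : fieldType) (d : L -> L) :=
  (forall x y, d (x + y) = d x + d y) /\ (forall x y, d (x * y) = d x * y + x * d y).

Section Derivations.
Variables (L : fieldType) (d : L -> L).
Hypothesis der : derivation d.

Lemma derD x y : d (x + y) = d x + d y. Proof. by case: der. Qed.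
Lemma derM x y : d (x * y) = d x * y + x * d y. Proof. by case: der. Qed.

Lemma der0 : d 0 = 0.
Proof. by apply: (@addrI _ (d 0)); rewrite -derD !addr0. Qed.

Lemma derN x : d (- x) = - d x.
Proof. by apply: (@addrI _ (d x)); rewrite -derD !subrr der0. Qed.

Lemma derB x y : d (x - y) = d x - d y.
Proof. by rewrite derD derN. Qed.

Lemma der1 : d 1 = 0.
Proof.
have := derM 1 1; rewrite !mulr1 mul1r => E.
by apply: (@addrI _ (d 1)); rewrite -E addr0.
Qed.

Lemma der_sum (I : Type) (r : seq I) (F : I -> L) :
  d (\sum_(i <- r) F i) = \sum_(i <- r) d (F i).
Proof. exact: (big_morph d derD der0). Qed.

Lemma derX x n : d (x ^+ n.+1) = n.+1%:R * x ^+ n * d x.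
Proof.
elim: n => [|n IHn]; first by rewrite expr1 expr0 !mul1r.
by rewrite exprS derM IHn -[n.+2%:R]natr1 !exprS; ring.
Qed.

Lemma derV x : d x^-1 = - d x / x ^+ 2.
Proof.
have [->|x0] := eqVneq x 0; first by rewrite invr0 der0 oppr0 mul0r.
have := derM x x^-1; rewrite divff // der1 => E.
have -> : d x^-1 = (d x * x^-1 + x * d x^-1) / x - d x / x ^+ 2 by field.
by rewrite -E mul0r add0r mulNr.
Qed.

Lemma der_logM x y : x != 0 -> y != 0 -> d (x * y) / (x * y) = d x / x + d y / y.
Proof. by move=> x0 y0; rewrite derM; field; rewrite x0 y0. Qed.

Lemma der_div x y : y != 0 -> d (x / y) = (d x * y - x * d y) / y ^+ 2.
Proof. by move=> y0; rewrite derM derV; field. Qed.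

End Derivations.

Lemma der_dlog_comm (L : fieldType) (d d' : L -> L) x :
  derivation d -> derivation d' -> x != 0 ->
  d (d' x) = d' (d x) -> d (d' x / x) = d' (d x / x).
Proof. by move=> der der' x0 c; rewrite !der_div // c (mulrC (d x)). Qed.

(** * Localization at a prime and orders of poles *)

Section LocalRing.
Variables (B : idomainType) (L : fieldType) (i : {rmorphism B -> L}).
Hypothesis i_inj : injective i.
Variable p : B.
Hypothesis pp : prime_elt p.

Lemma i_eq0 a : (i a == 0) = (a == 0).
Proof. by rewrite -(rmorph0 i) (inj_eq i_inj). Qed.

Let p0 : i p != 0.
Proof. by rewrite i_eq0; case: pp. Qed.

(** The localization of B at (p), inside [L]. Throughout, [loc (x / i p)] says that x lies in its
    maximal ideal, and [loc (i p ^+ n * x)] that x has a pole of order at most n. *)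
Definition loc x := exists a b, ~ divides p b /\ x * i b = i a.

Lemma ndivides_neq0 b : ~ divides p b -> i b != 0.
Proof. by move=> nb; rewrite i_eq0; apply/eqP => b0; apply: nb; rewrite b0; exact: divides0. Qed.

Lemma loc_i a : loc (i a).
Proof.
exists a, 1; rewrite rmorph1 mulr1; split=> //.
by apply: prime_elt_ndiv_unit => //; exact: unitr1.
Qed.

Lemma locV b : ~ divides p b -> loc (i b)^-1.
Proof. by move=> nb; exists 1, b; rewrite rmorph1 mulVf // ndivides_neq0. Qed.

Lemma locM x y : loc x -> loc y -> loc (x * y).
Proof.
move=> [a [b [nb xE]]] [a' [b' [nb' yE]]]; exists (a * a'), (b * b').
by split; [exact: prime_elt_ndivM|rewrite !rmorphM -xE -yE; ring].
Qed.

Lemma locD x y : loc x -> loc y -> loc (x + y).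
Proof.
move=> [a [b [nb xE]]] [a' [b' [nb' yE]]]; exists (a * b' + a' * b), (b * b').
by split; [exact: prime_elt_ndivM|rewrite rmorphD !rmorphM -xE -yE; ring].
Qed.

Lemma locN x : loc x -> loc (- x).
Proof. by move=> [a [b [nb xE]]]; exists (- a), b; rewrite rmorphN mulNr xE. Qed.

Lemma locB x y : loc x -> loc y -> loc (x - y).
Proof. by move=> lx ly; apply/locD/locN. Qed.

Lemma loc0 : loc 0.
Proof. by rewrite -(rmorph0 i); exact: loc_i. Qed.

Lemma loc1 : loc 1.
Proof. by rewrite -(rmorph1 i); exact: loc_i. Qed.

Lemma locX x n : loc x -> loc (x ^+ n).
Proof. by move=> lx; elim: n => [|n IHn]; [exact: loc1|rewrite exprS; exact: locM]. Qed.

Lemma loc_nat n : loc n%:R.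
Proof. by rewrite -(rmorph_nat i); exact: loc_i. Qed.

Lemma loc_sum (I : eqType) (r : seq I) (F : I -> L) :
  (forall t, t \in r -> loc (F t)) -> loc (\sum_(t <- r) F t).
Proof.
elim: r => [|t r IHr] lF; first by rewrite big_nil; exact: loc0.
rewrite big_cons; apply: locD; first by apply: lF; rewrite mem_head.
by apply: IHr => k kr; apply: lF; rewrite inE kr orbT.
Qed.

Lemma loc_horner (q : {poly L}) x : (forall k, loc q`_k) -> loc x -> loc q.[x].
Proof.
move=> lq lx; rewrite horner_coef; apply: loc_sum => k _.
by apply: locM => //; exact: locX.
Qed.

Lemma loc_divides a : loc (i a / i p) -> divides p a.
Proof.
move=> [c [b [nb E]]]; have /i_inj E' : i (a * b) = i (p * c).
  by rewrite !rmorphM -E; field.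
have [_ _ /(_ a b)[] //] := pp.
by exists c.
Qed.

Lemma mloc_prime x y : loc x -> loc y -> loc (x * y / i p) ->
  loc (x / i p) \/ loc (y / i p).
Proof.
move=> [a [b [nb xE]]] [a' [b' [nb' yE]]] [c [t [nt E]]].
have div z e f : ~ divides p f -> z * i f = i e -> divides p e -> loc (z / i p).
  move=> nf zE [q eE]; exists q, f; split=> //.
  by rewrite mulrAC zE eE rmorphM; field.
have [_ _ pP] := pp; have /pP[/pP[/div|/div]|//] : divides p (a * a' * t).
- exists (c * b * b'); apply: i_inj; rewrite !rmorphM -xE -yE -E; field; exact: p0.
- by move/(_ _ _ nb xE); left.
- by move/(_ _ _ nb' yE); right.
Qed.

Variables (d : L -> L) (der : derivation d).
Hypothesis d_stable : forall a, exists a', d (i a) = i a'.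

Lemma loc_der x : loc x -> loc (d x).
Proof.
move=> [a [b [nb xE]]]; have [a' aE] := d_stable a; have [b' bE] := d_stable b.
have b0 := ndivides_neq0 nb.
exists (a' * b - a * b'), (b * b); split; first exact: prime_elt_ndivM.
have -> : x = i a / i b by rewrite -xE mulfK.
by rewrite der_div // aE bE rmorphB !rmorphM; field.
Qed.

Lemma loc_der_pole x n : loc (i p ^+ n * x) -> loc (i p ^+ n.+1 * d x).
Proof.
move=> lx; case: n => [|n] in lx *.
  by rewrite expr1; rewrite expr0 mul1r in lx; apply: locM; [exact: loc_i|exact: loc_der].
have -> : i p ^+ n.+2 * d x = i p * d (i p ^+ n.+1 * x) - n.+1%:R * (i p ^+ n.+1 * x) * d (i p).
  by rewrite derM // derX // !exprS; ring.
have lp : loc (i p) := loc_i p.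
by apply: locB; apply: locM; rewrite ?loc_nat //; first 1 [exact: loc_der|apply: locM => //; exact: loc_nat|exact: loc_der].
Qed.

Definition frac x := exists a b, b != 0 /\ x * i b = i a.

Hypothesis nat_unit : forall n, (n.+1%:R : B) \is a GRing.unit.
Hypothesis fB : factorial_ring B.
Variable p' : B.
Hypothesis dp : d (i p) = i p'.
Hypothesis np' : ~ divides p p'.

(* In characteristic 0, differentiation raises the order of a genuine pole by exactly one. *)
Lemma loc_antiderivative x n : frac x -> loc (i p ^+ n.+1 * d x) -> loc (i p ^+ n * x).
Proof.
move=> [a [b [b0 xE]]] ldx.
have [a0|a0] := eqVneq a 0.
  have ib0 : i b != 0 by rewrite i_eq0.
  have -> : x = 0 by apply: (mulIf ib0); rewrite mul0r xE a0 rmorph0.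
  by rewrite mulr0; exact: loc0.
have [k [g [ng aE]]] := factorial_prime_power fB pp a0.
have [l [h [nh bE]]] := factorial_prime_power fB pp b0.
have g0 := ndivides_neq0 ng; have h0 := ndivides_neq0 nh.
have {xE} xE : x = i p ^+ k * i g / (i p ^+ l * i h).
  rewrite -!rmorphXn -!rmorphM -aE -bE -xE mulfK //; by rewrite i_eq0.
have lv : loc (i g / i h) by apply: locM; [exact: loc_i|exact: locV].
have [le|lt] := leqP l (n + k).
  have -> : i p ^+ n * x = i p ^+ (n + k - l) * (i g / i h).
    have : i p ^+ (n + k) = i p ^+ (n + k - l) * i p ^+ l by rewrite -exprD subnK.
    rewrite exprD => E; have P0 : i p ^+ l != 0 by rewrite expf_neq0.
    rewrite xE; transitivity ((i p ^+ n * i p ^+ k) * i g / (i p ^+ l * i h)).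
      by rewrite !mulrA.
    by rewrite E; field; rewrite P0 h0.
  by apply: locM => //; apply/locX/loc_i.
have {lt} [t lE] : exists t, l = (k + (n + t).+1)%N by exists (l - k - n.+1)%N; lia.
set v := i g / i h in lv.
have xv : x = v / i p ^+ (n + t).+1.
  rewrite xE lE exprD /v; have P0 m : i p ^+ m != 0 by rewrite expf_neq0.
  by field; rewrite ?P0 ?h0 ?p0.
(* Here x = v / p^(n+t+1) with [v] a unit at [p], a pole of order above n. Multiplying the
   hypothesis by p^t isolates the leading polar term (n+t+1) v p' / p of the derivative, which would
   then be regular. *)
have : loc (i p ^+ t * (i p ^+ n.+1 * d x)) by apply: locM => //; apply/locX/loc_i.
have -> : i p ^+ t * (i p ^+ n.+1 * d x) = d v - (n + t).+1%:R * v * i p' / i p.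
  have P0 m : i p ^+ m != 0 by rewrite expf_neq0.
  rewrite xv (der_div der v) // (derX der (i p)) dp.
  have -> : i p ^+ n.+1 = i p * i p ^+ n by rewrite exprS.
  have -> : i p ^+ (n + t).+1 = i p * i p ^+ n * i p ^+ t by rewrite exprS exprD mulrA.
  by rewrite exprD; field; rewrite ?P0 ?p0.
move=> l1; have {l1} l2 : loc ((n + t).+1%:R * v * i p' / i p).
  have -> : (n + t).+1%:R * v * i p' / i p = d v - (d v - (n + t).+1%:R * v * i p' / i p) by ring.
  by apply: locB => //; exact: loc_der.
set N : B := (n + t).+1%:R; have uN : N \is a GRing.unit := nat_unit _.
have iN : (n + t).+1%:R = i N by rewrite rmorph_nat.
have N0 : i N != 0 by rewrite i_eq0; apply: contraTneq uN => ->; rewrite unitr0.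
have : loc (i (g * p') / i p).
  have -> : i (g * p') / i p = i N^-1 * ((n + t).+1%:R * v * i p' / i p) * i h.
    rewrite iN rmorphV // rmorphM /v; move: (i N) N0 => z z0.
    by field; rewrite z0 p0 h0.
  by apply: locM; [apply: locM => //|]; exact: loc_i.
by move/loc_divides; case: (pp) => _ _ pP /pP[].
Qed.

(** Since p^n x has a denominator prime to [p], the numerator [a] is divisible by [p] and one factor
    cancels. *)
Lemma loc_denominator x n a h : loc (i p ^+ n * x) -> x * i (p ^+ n.+1 * h) = i a ->
  exists a', x * i (p ^+ n * h) = i a'.
Proof.
move=> [c [b [nb cE]]] aE.
have [_ _ /(_ a b) pP] := pp; have {pP} [|[a' a'E]|/nb//] := pP.
  exists (c * h); apply: i_inj; rewrite !rmorphM -aE -cE !rmorphM exprS !rmorphM.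
  by rewrite rmorphXn; ring.
exists a'; apply: (mulfI p0); rewrite -rmorphM -a'E -aE exprS !rmorphM.
by ring.
Qed.

End LocalRing.

(** * Algebraic relations modulo a prime *)

Lemma fraction_numden (A : idomainType) (x : {fraction A}) :
  x * tofrac \d_(repr x) = tofrac \n_(repr x).
Proof.
rewrite -{1}[x]reprK -[X in (\pi X)%qT]Ratio_numden !piE; apply/eqmodP.
by rewrite /= FracField.equivfE /FracField.mulf !numden_Ratio ?mulr1 ?oner_eq0 ?denom_ratioP //= mulrC.
Qed.

Lemma fraction_repr (A : idomainType) (x : {fraction A}) :
  exists a b : A, b != 0 /\ x * tofrac b = tofrac a.
Proof.
exists \n_(repr x), \d_(repr x); split; [exact: denom_ratioP|exact: fraction_numden].
Qed.

Lemma fraction_poly_repr (A : idomainType) (w : {poly {fraction A}}) :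
  exists (b : A) w', b != 0 /\ tofrac b *: w = map_poly (@tofrac A) w'.
Proof.
elim/poly_ind: w => [|w x [b [w' [b0 E]]]].
  by exists 1, 0; rewrite oner_eq0 scaler0 rmorph0.
have [a [c [c0 xE]]] := fraction_repr x.
exists (b * c), (c%:P * w' * 'X + (b * a)%:P); rewrite mulf_neq0 //; split=> //.
rewrite rmorphD !rmorphM /= map_polyX !map_polyC /= -E -!mul_polyC rmorphM /= -xE.
by rewrite !polyCM; ring.
Qed.

(** With n = [size p], the n powers 1, H, ..., H^(n-1) are linearly dependent in F[x]/(p), which has
    dimension n - 1. *)
Lemma algebraic_modp (F : fieldType) (p H : {poly F}) : p != 0 ->
  exists2 M : {poly F}, M != 0 & p %| M \Po H.
Proof.
move=> p0; set n := size p; have n0 : (0 < n)%N by rewrite size_poly_gt0.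
pose mat : 'M[F]_(n, n.-1) := \matrix_(k < n) poly_rV ((H ^+ k) %% p).
have : kermx mat != 0.
  rewrite kermx_eq0 /row_free neq_ltn; apply/orP; left.
  by rewrite (leq_ltn_trans (rank_leq_col _)) // ltn_predL.
move=> /rowV0Pn[v /sub_kermxP vm v0]; exists (rVpoly v).
  by apply: contraNneq v0 => E; rewrite -(rVpolyK v) E linear0.
rewrite /comp_poly (@horner_coef_wide _ n); last first.
  by rewrite (leq_trans (size_poly _ _)) // size_poly.
have modp_sum (G : 'I_n -> {poly F}) : (\sum_k G k) %% p = \sum_k (G k %% p).
  by apply: (big_morph (fun x => x %% p)); [move=> x y; rewrite modpD|rewrite mod0p].
apply/modp_eq0P; rewrite modp_sum.
transitivity (rVpoly (v *m mat)); last by rewrite vm linear0.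
rewrite mulmx_sum_row linear_sum /=; apply: eq_bigr => k _.
rewrite linearZ /= rowK poly_rV_K; last by rewrite -ltnS prednK // ltn_modp.
by rewrite coef_map /= mul_polyC modpZl coef_rVpoly_ord.
Qed.

(** Denominators are cleared in a relation over the fraction field and in its cofactor. The constant
    [c] that this puts in front is not divisible by [p], which has positive degree, so primality
    removes it. *)
Lemma algebraic_mod_prime (A : idomainType) (p H : {poly A}) :
  prime_elt p -> (1 < size p)%N ->
  exists2 M : {poly A}, M != 0 & divides p (M \Po H).
Proof.
move=> pp szp; pose t := map_poly (@tofrac A).
have t_inj : injective t by apply: map_inj_poly; [move=> x y /eqP; rewrite tofrac_eq => /eqP|rewrite rmorph0].
have p0 : t p != 0 by rewrite -(rmorph0 t) (inj_eq t_inj); case: pp.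
have [M M0 /dvdpP[w wE]] := algebraic_modp (t H) p0.
have [b [M' [b0 M'E]]] := fraction_poly_repr M.
have [c [w' [c0 w'E]]] := fraction_poly_repr w.
have tf0 x : x != 0 -> tofrac x != 0 :> {fraction A} by rewrite tofrac_eq0.
exists M'.
  apply: contraNneq M0 => M'0; move/eqP: M'E.
  by rewrite M'0 rmorph0 scaler_eq0 (negPf (tf0 _ b0)).
have E : c%:P * (M' \Po H) = p * (b%:P * w').
  apply: t_inj; rewrite /t !rmorphM /= !map_polyC /= map_comp_poly -M'E -w'E.
  by rewrite comp_polyZ wE -!mul_polyC /t; ring.
have [_ _ /(_ c%:P (M' \Po H))[|[q qE]|//]] := pp; first by exists (b%:P * w').
have := congr1 (fun P => size (polyseq P)) qE.
have q0 : q != 0 by apply: contraNneq c0 => q0; rewrite -polyC_eq0 qE q0 mulr0.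
have p0' : p != 0 by case: pp.
rewrite /= size_polyC c0 size_mul // => sz.
have : (0 < size q)%N by rewrite size_poly_gt0.
by move: sz szp; clear; lia.
Qed.

(** * Elimination of a variable from a closed form *)

Section Forms.
Variables (K : closedFieldType) (L : fieldType) (cK : {rmorphism K -> L}).
Variables (J : finType) (D : J -> L -> L).

Definition closed_form (w : J -> L) := forall j k, D j (w k) = D k (w j).

Definition log_exact (w : J -> L) := exists (s : seq (K * L)) u,
  (forall t, t \in s -> t.2 != 0) /\
  forall j, w j = \sum_(t <- s) cK t.1 * (D j t.2 / t.2) + D j u.

Hypothesis der : forall j, derivation (D j).
Hypothesis commD : forall j k x, D j (D k x) = D k (D j x).
Hypothesis DcK : forall j c, D j (cK c) = 0.
Hypothesis constK : forall x, (forall j, D j x = 0) -> exists c, x = cK c.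

Let D0 j := der0 (der j).
Let DN j := derN (der j).
Let DD j := derD (der j).
Let DB j := derB (der j).
Let DM j := derM (der j).
Let DX j := derX (der j).
Let Dsum j := der_sum (der j).
Let Ddiv j := der_div (der j).

Lemma log_exact_d u : log_exact (fun j => D j u).
Proof. by exists [::], u; split=> // j; rewrite big_nil add0r. Qed.

Lemma log_exact_dlog c q : q != 0 -> log_exact (fun j => cK c * (D j q / q)).
Proof.
move=> q0; exists [:: (c, q)], 0; split=> [t|j]; first by rewrite inE => /eqP ->.
by rewrite big_seq1 D0 // addr0.
Qed.

Lemma log_exact_trans w w' : log_exact (fun j => w j - w' j) -> log_exact w' -> log_exact w.
Proof.
move=> [s [u [s0 E]]] [s' [u' [s'0 E']]]; exists (s ++ s'), (u + u'); split.
  by move=> t; rewrite mem_cat => /orP[/s0|/s'0].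
by move=> j; rewrite big_cat (DD) /= addrACA -E -E' subrK.
Qed.

Lemma log_exact_closed w : log_exact w -> closed_form w.
Proof.
move=> [s [u [s0 E]]] j k; rewrite !E !DD // commD; congr (_ + _).
rewrite !Dsum // [LHS]big_seq [RHS]big_seq; apply: eq_bigr => t /s0 t0.
rewrite (DM j (cK _)) (DM k (cK _)) !DcK !mul0r !add0r.
by rewrite (der_dlog_comm (der j) (der k) t0 (commD j k _)).
Qed.

Lemma closed_formB w w' : closed_form w -> closed_form w' ->
  closed_form (fun j => w j - w' j).
Proof. by move=> cw cw' j k; rewrite !DB // cw cw'. Qed.

Section Elimination.
Variables (A : idomainType) (i : {rmorphism {poly A} -> L}).
Variables (j0 : J) (dA : J -> A -> A).
Hypothesis i_inj : injective i.
Hypothesis fA : factorial_ring A.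
Hypothesis nat_unit : forall n, (n.+1%:R : A) \is a GRing.unit.
Hypothesis Dj0 : forall P, D j0 (i P) = i P^`().
Hypothesis DA : forall j a, D j (i a%:P) = i (dA j a)%:P.
Hypothesis stable : forall j P, exists Q, D j (i P) = i Q.
Hypothesis cKA : forall c, exists a, cK c = i a%:P.

Let nat_unit_poly n : (n.+1%:R : {poly A}) \is a GRing.unit.
Proof. by rewrite -(rmorph_nat polyC) rmorph_unit. Qed.

Let nat_neq0 n : (n.+1%:R : A) != 0.
Proof. by apply: contraTneq (nat_unit n) => ->; rewrite unitr0. Qed.

Let i0 P : (i P == 0) = (P == 0). Proof. exact: i_eq0. Qed.

Let iC0 c : c != 0 -> i c%:P != 0.
Proof. by rewrite i0 polyC_eq0. Qed.

Let fP : factorial_ring {poly A}. Proof. exact: factorial_poly. Qed.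

Lemma deriv_eq0 (P : {poly A}) : P^`() = 0 -> P = (P`_0)%:P.
Proof.
move=> dP; apply/polyP => -[|k]; rewrite coefC //=.
have /(congr1 (fun Q : {poly A} => Q`_k)) := dP; rewrite coef_deriv coef0 => /eqP.
by rewrite -mulr_natr mulf_eq0 (negPf (nat_neq0 k)) orbF => /eqP.
Qed.

Lemma ndivides_size (p q : {poly A}) : q != 0 -> (size q < size p)%N -> ~ divides p q.
Proof.
move=> q0 lt [c qE]; have c0 : c != 0 by apply: contraNneq q0 => c0; rewrite qE c0 mulr0.
have p0 : p != 0 by apply: contraNneq q0 => p0; rewrite qE p0 mul0r.
have : (0 < size c)%N by rewrite size_poly_gt0.
by move: lt; rewrite qE size_mul //; lia.
Qed.

Lemma ndivides_polyC (p : {poly A}) c : (1 < size p)%N -> c != 0 -> ~ divides p c%:P.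
Proof. by move=> szp c0; apply: ndivides_size; rewrite ?polyC_eq0 // size_polyC c0. Qed.

Lemma ndivides_deriv (p : {poly A}) : (1 < size p)%N -> ~ divides p p^`().
Proof.
move=> szp; have p0 : p != 0 by rewrite -size_poly_gt0 ltnW.
apply: ndivides_size; last exact: lt_size_deriv.
apply/eqP => /deriv_eq0 pE; move: szp; rewrite pE size_polyC.
by case: (_ != 0).
Qed.

(** Let g be the gcd and k p = t g. The prime [p] divides t, which makes g constant, or it divides
    g, which would make it divide [q]. Over A the Bezout relation reaches a nonzero constant
    only. *)
Lemma prime_bezout (p q : {poly A}) : prime_elt p -> (1 < size p)%N -> ~ divides p q ->
  exists u v c, c != 0 /\ u * p + v * q = c%:P.
Proof.
move=> pp szp npq; have [p0 _ pP] := pp.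
have cop : coprimep p q.
  have [[k t] /= k0 Et] := Pdiv.Idomain.dvdpP _ _ (dvdp_gcdl p q).
  have [[l r] /= l0 Er] := Pdiv.Idomain.dvdpP _ _ (dvdp_gcdr p q).
  have : divides p (t * gcdp p q) by rewrite -Et -mul_polyC; exact/divides_mull/divides_refl.
  case/pP => [[s tE]|dg].
    rewrite tE -mul_polyC mulrC -mulrA in Et; have {}Et := mulfI p0 Et.
    have := congr1 (fun Q : {poly A} => size Q) Et; rewrite /= size_polyC k0.
    have s0 : s != 0 by apply: contraNneq k0 => s0; rewrite -polyC_eq0 Et s0 mul0r.
    have g0 : gcdp p q != 0 by rewrite gcdp_eq0 negb_and p0.
    rewrite size_mul // /coprimep; rewrite -!size_poly_gt0 in s0 g0.
    by move: s0 g0; lia.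
  have : divides p (l%:P * q) by rewrite mul_polyC Er; exact: divides_mull.
  by case/pP => //; move/ndivides_polyC; case.
have /Bezout_coprimepP[[u v] /= uv] := cop.
have : size (u * p + v * q) == 1%N by rewrite size_poly_eq1.
by move=> /size_poly1P[c c0 cE]; exists u, v, c.
Qed.

Lemma prime_factor_size (P : {poly A}) : (1 < size P)%N -> exists p : {poly A},
  [/\ prime_elt p, (1 < size p)%N & divides p P].
Proof.
move=> szP; have P0 : P != 0 by rewrite -size_poly_gt0 ltnW.
have [u [s [uu ps PE]]] := fP P0.
have {P0} : (1 < size (\prod_(q <- s) q)%R)%N.
  move: szP; rewrite PE; move: uu; rewrite poly_unitE => /andP[/size_poly1P[c c0 ->] _].
  by rewrite mul_polyC size_scale.
have : forall q, q \in s -> divides q P.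
  move=> q qs; rewrite PE; apply: divides_mull.
  by rewrite (big_rem q qs) /=; exact/divides_mulr/divides_refl.
elim: s ps {PE} => [|q s IHs] ps dP; first by rewrite big_nil size_poly1.
have pq : prime_elt q by apply: ps; rewrite mem_head.
have [lt _|] := ltnP 1 (size q); first by exists q; split=> //; apply: dP; rewrite mem_head.
move=> /size1_polyC qE; rewrite big_cons qE mul_polyC.
rewrite size_scale; last by rewrite -polyC_eq0 -qE; case: pq.
by apply: IHs => t ts; [apply: ps|apply: dP]; rewrite inE ts orbT.
Qed.

(** * Residues along a prime are constants *)

Section Residue.
Variables (p : {poly A}) (lam : L).
Hypotheses (pp : prime_elt p) (szp : (1 < size p)%N).
Local Notation loc := (loc i p).

Let ev (M : {poly A}) := (map_poly (i \o polyC) M).[lam].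

Let evD M N : ev (M + N) = ev M + ev N.
Proof. by rewrite /ev rmorphD hornerD. Qed.

Let evM M N : ev (M * N) = ev M * ev N.
Proof. by rewrite /ev rmorphM hornerM. Qed.

Let evC c : ev c%:P = i c%:P.
Proof. by rewrite /ev map_polyC hornerC. Qed.

Let evX : ev 'X = lam.
Proof. by rewrite /ev map_polyX hornerX. Qed.

Let dA0 j : dA j 0 = 0.
Proof. by apply/polyC_inj/i_inj; rewrite -DA polyC0 rmorph0 der0. Qed.

Lemma der_ev j M : D j (ev M) = ev (map_poly (dA j) M) + ev M^`() * D j lam.
Proof.
elim/poly_ind: M => [|M c IHM].
  have -> : map_poly (dA j) 0 = 0 by apply/polyP => k; rewrite coef_map_id0 // !coef0 dA0.
  by rewrite deriv0 -polyC0 evC polyC0 rmorph0 D0 // mul0r addr0.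
have -> : map_poly (dA j) (M * 'X + c%:P) = map_poly (dA j) M * 'X + (dA j c)%:P.
  apply/polyP => k; rewrite coef_map_id0 // !coefD !coefC !coefMX coef_map_id0 //.
  by case: k => [|k] /=; rewrite ?add0r ?addr0.
rewrite derivD derivC derivM derivX mulr1 addr0 !(evD, evM, evC, evX) DD // DM // IHM DA.
by ring.
Qed.

Hypothesis lam_loc : loc lam.
(** The derivation D_{j0}(p) D_j - D_j(p) D_{j0} kills [p], hence acts on the residue field of [p];
    the hypothesis says that it kills the class of [lam] there. *)
Hypothesis hamiltonian : forall j,
  loc ((D j lam * D j0 (i p) - D j0 lam * D j (i p)) / i p).

Let p0 : i p != 0.
Proof. by rewrite i0; case: pp. Qed.

Let loc1p : ~ loc (1 / i p).
Proof.
rewrite -(rmorph1 i) => /(loc_divides i_inj pp); apply: prime_elt_ndiv_unit => //.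
exact: unitr1.
Qed.

Let loc_ev M : loc (ev M).
Proof. by apply: loc_horner => // k; rewrite coef_map; exact: loc_i. Qed.

(* The residue is algebraic over [Frac A] modulo [p]; in a shortest relation all ratios
   of coefficients are killed by every derivation, hence lie in the constant field. *)
Lemma residue_constant_of_relation M : M != 0 -> loc (ev M / i p) ->
  exists c : K, loc ((lam - cK c) / i p).
Proof.
have [n] := ubnP (size M); elim: n M => // n IHn M szM M0 locM_.
set m := lead_coef M; have m0 : m != 0 by rewrite lead_coef_eq0.
(* The coefficients of [M] are differentiated, and the multiple of [M] cancelling the leading term
   is subtracted: the result is shorter, and is again a relation for [lam] modulo [p]. *)
pose T j := m%:P * map_poly (dA j) M - (dA j m)%:P * M.
have locT j : loc (ev (T j) / i p).
  have locd : loc (ev (map_poly (dA j) M) / i p).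
    have [z zE] : exists z, z = ev M / i p by exists (ev M / i p).
    rewrite -zE in locM_; have {}zE : ev M = i p * z by rewrite zE; field.
    (* D_{j0}(p) D_j - D_j(p) D_{j0} is applied to the relation ev M = p z. It kills [p], and [lam]
       modulo [p]; the coefficients are constant in direction [j0]. What survives is p' times the
       value of the differentiated relation, and [p] does not divide p'. *)
    have : loc (i p^`() * ev (map_poly (dA j) M) / i p).
      have -> : i p^`() * ev (map_poly (dA j) M) / i p
        = (D j0 (i p) * D j z - D j (i p) * D j0 z)
          - ev M^`() * ((D j lam * D j0 (i p) - D j0 lam * D j (i p)) / i p).
        have e0 : map_poly (dA j0) M = 0.
          apply/polyP => k; rewrite coef_map_id0 // coef0; apply/polyC_inj/i_inj.
          by rewrite -DA Dj0 derivC.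
        have := der_ev j M; have := der_ev j0 M; rewrite e0 -polyC0 evC polyC0 rmorph0 add0r.
        rewrite zE !DM // => E0 E1.
        have -> : ev (map_poly (dA j) M) = D j (i p) * z + i p * D j z - ev M^`() * D j lam.
          by rewrite E1; ring.
        rewrite -Dj0; apply: (mulIf p0); rewrite mulfVK // mulrBl -!mulrA mulVf // mulr1.
        rewrite mulrBr [in RHS]mulrBr.
        have -> : ev M^`() * (D j0 lam * D j (i p)) = (D j0 (i p) * z + i p * D j0 z) * D j (i p).
          by rewrite E0; ring.
        by ring.
      have lD k : loc (D k (i p)) by have [Q ->] := stable k p; exact: loc_i.
      have lz k : loc (D k z) := loc_der i_inj pp (der k) (stable k) locM_.
      apply: locB => //; last by apply: locM.
      by apply: locB => //; apply: locM.
    have lp' : loc (i p^`()) by exact: loc_i.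
    case/(mloc_prime i_inj pp lp' (loc_ev _)) => //.
    by move/(loc_divides i_inj pp)/ndivides_deriv.
  rewrite /T evD evM evC -mulNr -polyCN evM evC mulrDl -!mulrA.
  by apply: locD => //; apply: locM => //; exact: loc_i.
have szT j : T j != 0 -> (size (T j) < n)%N.
  move=> T0; rewrite -ltnS (leq_trans _ szM) // ltnS.
  have szM0 : (0 < size M)%N by rewrite size_poly_gt0.
  suff : (size (T j) <= (size M).-1)%N by rewrite -ltnS prednK.
  apply/leq_sizeP => k; rewrite leq_eqVlt => /orP[/eqP <-|lt].
    by rewrite coefB !coefCM coef_map_id0 // -lead_coefE mulrC subrr.
  rewrite coefB !coefCM coef_map_id0 // nth_default ?dA0 ?mulr0 ?subrr //.
  by move: lt; rewrite prednK.
case: (classic (exists j, T j != 0)) => [[j Tj]|noT].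
  by apply: IHn (locT j) => //; exact: szT.
have {noT} T0 j : T j = 0 by apply/eqP/negPn/negP => Tj; apply: noT; exists j.
have im0 := iC0 m0.
have cst k : exists x, i (M`_k)%:P / i m%:P == cK x.
  have [|x ->] := @constK (i (M`_k)%:P / i m%:P); last by exists x.
  move=> j; rewrite Ddiv // !DA.
  have /(congr1 (fun P : {poly A} => P`_k)) := T0 j.
  rewrite /T coefB !coefCM coef_map_id0 // coef0 => /eqP; rewrite subr_eq0 => /eqP E.
  rewrite -!rmorphM (mulrC _ m) E (mulrC M`_k) subrr mul0r.
  by [].
pose M0' := \poly_(k < size M) xchoose (cst k).
have evE : ev M = i m%:P * (map_poly cK M0').[lam].
  have -> : ev M = (i m%:P *: map_poly cK M0').[lam]; last by rewrite hornerZ.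
  rewrite /ev; congr (_.[_]); apply/polyP => k.
  rewrite coefZ !coef_map /= coef_poly; case: ltnP => [lt|le].
    by have /eqP <- := xchooseP (cst k); rewrite mulrC mulfVK.
  by rewrite nth_default // !rmorph0 mulr0.
have M0'0 : M0' != 0.
  have szM0 : (0 < size M)%N by rewrite size_poly_gt0.
  apply/eqP => /(congr1 (fun P : {poly K} => P`_(size M).-1)).
  rewrite coef_poly coef0 prednK // leqnn => E.
  have /eqP := xchooseP (cst (size M).-1); rewrite E rmorph0 -lead_coefE divff //.
  by move/eqP; rewrite oner_eq0.
(* The relation now has coefficients in K, so it splits into linear factors; the maximal ideal of
   the localization, being prime, contains one of the lam - z. *)
have [r M0'E] := closed_field_poly_normal M0'.
set l := lead_coef M0' in M0'E; have l0 : l != 0 by rewrite lead_coef_eq0.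
have lcK c : loc (cK c) by have [a ->] := cKA c; exact: loc_i.
move: locM_; rewrite evE M0'E map_polyZ hornerZ rmorph_prod /=.
rewrite horner_prod.
under eq_bigr => z _ do rewrite rmorphB /= map_polyX map_polyC hornerXsubC.
have lz z : loc (lam - cK z) by exact: locB.
have lprod (s : seq K) : loc (\prod_(z <- s) (lam - cK z)).
  elim: s => [|z s IHs]; first by rewrite big_nil; exact: loc1.
  by rewrite big_cons; exact: locM.
have lm : loc (i m%:P) by exact: loc_i.
case/(mloc_prime i_inj pp lm (locM pp (lcK l) (lprod r))).
  by move/(loc_divides i_inj pp)/ndivides_polyC; case.
case/(mloc_prime i_inj pp (lcK l) (lprod r)) => [ll|].
  case: loc1p; have -> : 1 / i p = cK l^-1 * (cK l / i p).
    by rewrite mulrA -rmorphM mulVf // rmorph1.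
  exact: locM.
elim: r {M0'E} => [|z r IHr]; first by rewrite big_nil => /loc1p.
rewrite big_cons; case/(mloc_prime i_inj pp (lz z) (lprod r)) => // lzz.
by exists z.
Qed.

End Residue.

Lemma residue_constant (p H : {poly A}) c : prime_elt p -> (1 < size p)%N -> c != 0 ->
  (forall j, loc i p ((D j (i H / i c%:P) * D j0 (i p) - D j0 (i H / i c%:P) * D j (i p)) / i p)) ->
  exists x : K, loc i p ((i H / i c%:P - cK x) / i p).
Proof.
move=> pp szp c0 ham; have ic0 := iC0 c0.
have [M M0 [N NE]] := algebraic_mod_prime H pp szp.
(* The powers of [c] turn a relation for [H] into one for the quotient: M'(H / c) = M(H). *)
pose M' := \poly_(k < size M) (M`_k * c ^+ k).
have szM0 : (0 < size M)%N by rewrite size_poly_gt0.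
apply: (@residue_constant_of_relation p _ pp szp _ ham M').
- by apply: locM => //; [exact: loc_i|apply: locV => //; exact: ndivides_polyC].
- apply/eqP => /(congr1 (fun P : {poly A} => P`_(size M).-1)).
  rewrite coef_poly coef0 prednK // leqnn => /eqP.
  by rewrite mulf_eq0 expf_eq0 (negPf c0) andbF orbF -lead_coefE lead_coef_eq0 (negPf M0).
have -> : (map_poly (i \o polyC) M').[i H / i c%:P] = i (M \Po H).
  rewrite comp_polyE rmorph_sum /= (@horner_coef_wide _ (size M)); last first.
    by rewrite (leq_trans (size_poly _ _)) // size_poly.
  apply: eq_bigr => k _; rewrite coef_map /= coef_poly ltn_ord polyCM rmorphM /=.
  rewrite -mul_polyC rmorphM rmorphXn /= expr_div_n rmorphXn rmorphXn /=.
  rewrite -mulrA; congr (_ * _); rewrite mulrCA divff ?mulr1 //.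
  by rewrite expf_neq0.
rewrite NE rmorphM mulrAC divff ?mul1r; first exact: loc_i.
by rewrite i0; case: pp.
Qed.

(** * Hermite reduction at one prime *)

Section ReducePole.
Variables (p g : {poly A}) (w : J -> L) (e : nat).
Hypotheses (pp : prime_elt p) (szp : (1 < size p)%N) (npg : ~ divides p g).
Hypothesis cw : closed_form w.
Hypothesis dw : forall j, exists b, w j * i (p ^+ e.+1 * g) = i b.

Let p0 : i p != 0. Proof. by rewrite i0; case: pp. Qed.
Let g0 : i g != 0. Proof. exact: ndivides_neq0 npg. Qed.

(** Multiplying the numerator by a Bezout relation c = u p + v p' g separates a part h p' / (c
    p^(e+1)), which a derivative or a logarithmic derivative can absorb, from a part of pole order
    at most e. *)
Lemma hermite_reduction : exists h u c,
  c != 0 /\ w j0 = i h * i p^`() / (i c%:P * i p ^+ e.+1) + i u / (i p ^+ e * (i c%:P * i g)).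
Proof.
have [b bE] := dw j0.
have npq : ~ divides p (p^`() * g) by apply: prime_elt_ndivM => //; exact: ndivides_deriv.
have [u [v [c [c0 E]]]] := prime_bezout pp szp npq.
exists (b * v), (b * u), c; split=> //; have ic0 := iC0 c0.
have P0 : i p ^+ e != 0 by rewrite expf_neq0.
have -> : w j0 = i b / (i p * i p ^+ e * i g).
  by rewrite -bE rmorphM rmorphXn exprS mulfK // !mulf_neq0.
rewrite !rmorphM exprS; apply/eqP; rewrite -subr_eq0; apply/eqP.
transitivity (i b * (i c%:P - (i u * i p + i v * (i p^`() * i g))) / (i c%:P * i p * i p ^+ e * i g)).
  by field; rewrite P0 p0 g0 ic0.
by rewrite -!rmorphM -rmorphD -E subrr mulr0 mul0r.
Qed.

Lemma frac_denominator (w' : L) (P b : {poly A}) : P != 0 -> w' * i P = i b -> frac i w'.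
Proof. by move=> P0 E; exists b, P. Qed.

(** Closedness gives D_{j0} (w'_j) = D_j (w'_{j0}), of pole order at most n + 1; integrating in
    direction [j0] brings w'_j down to order n. So it suffices to control the component [j0]. *)
Lemma loc_all (w' : J -> L) n : closed_form w' -> (forall j, frac i (w' j)) ->
  loc i p (i p ^+ n * w' j0) -> forall j, loc i p (i p ^+ n * w' j).
Proof.
move=> cw' fw' l0 j.
apply: (loc_antiderivative i_inj pp (der j0) _ nat_unit_poly fP (Dj0 p)) => //.
- exact: ndivides_deriv.
- by rewrite cw'; apply: (loc_der_pole i_inj pp (der j)).
Qed.
End ReducePole.

(** Write w_{j0} = lam p' / p + regular. By closedness the [j0]-derivative of w_k - lam D_k(p) / p
    is, up to a regular term, (D_k(lam) D_{j0}(p) - D_{j0}(lam) D_k(p)) / p. A derivative in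
    direction [j0] never has a pole of order exactly one along [p], so this quotient is regular and
    lam is constant modulo [p]. *)
Lemma reduce_simple_pole (p g : {poly A}) w : prime_elt p -> (1 < size p)%N -> ~ divides p g ->
  closed_form w -> (forall j, exists b, w j * i (p * g) = i b) ->
  exists x : K, loc i p (w j0 - cK x * (D j0 (i p) / i p)).
Proof.
move=> pp szp npg cw dw.
have p0 : i p != 0 by rewrite i0; case: pp.
have g0 : i g != 0 := ndivides_neq0 i_inj npg.
have [|h [u [c [c0 wE]]]] := @hermite_reduction p g w 0 pp szp npg; first by move=> j; rewrite expr1.
have ic0 := iC0 c0; rewrite expr1 expr0 mul1r in wE.
have lu : loc i p (i u / (i c%:P * i g)).
  rewrite invfM mulrA; apply: locM => //; last exact: locV.
  by apply: locM => //; [exact: loc_i|apply: locV => //; exact: ndivides_polyC].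
have [lam lamE] : exists lam, lam = i h / i c%:P by exists (i h / i c%:P).
have w0E : w j0 - lam * (D j0 (i p) / i p) = i u / (i c%:P * i g).
  by rewrite wE lamE Dj0; field; rewrite ic0 p0 g0.
have fl : loc i p lam.
  by rewrite lamE; apply: locM => //; [exact: loc_i|apply: locV => //; exact: ndivides_polyC].
have lder k x : loc i p x -> loc i p (D k x) by apply: loc_der.
have lDp k : loc i p (D k (i p)) by apply: (lder); exact: loc_i.
have key k : D j0 (w k - lam * (D k (i p) / i p))
    = (D k lam * D j0 (i p) - D j0 lam * D k (i p)) / i p + D k (i u / (i c%:P * i g)).
  rewrite -w0E !DB (cw j0 k) (DM j0 lam) (DM k lam).
  by rewrite (der_dlog_comm (der j0) (der k)) //; ring.
have ham k : loc i p ((D k lam * D j0 (i p) - D j0 lam * D k (i p)) / i p).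
  have -> : (D k lam * D j0 (i p) - D j0 lam * D k (i p)) / i p
     = D j0 (w k - lam * (D k (i p) / i p)) - D k (i u / (i c%:P * i g)) by rewrite key addrK.
  apply: locB => //; last exact: lder.
  apply: (lder); rewrite -[X in loc _ _ X]mul1r -(expr0 (i p)).
  apply: (loc_antiderivative i_inj pp (der j0) _ nat_unit_poly fP (Dj0 p)).
  - by move=> a; exists a^`().
  - exact: ndivides_deriv.
  - have [b bE] := dw k; have [q qE] := stable k p.
    exists (b * c%:P - h * q * g), (p * g * c%:P); split.
      rewrite -i0 !rmorphM !mulf_neq0 //.
    by rewrite lamE qE rmorphB !rmorphM -bE !rmorphM; field; rewrite ic0 p0.
  - rewrite key expr1 mulrDr mulrC divfK //; apply: locD => //.
      by apply: locB => //; apply: locM => //; exact: lder.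
    by apply: locM => //; [exact: loc_i|exact: lder].
rewrite lamE in ham; have [x xE] := residue_constant pp szp c0 ham.
exists x; have -> : w j0 - cK x * (D j0 (i p) / i p)
   = i u / (i c%:P * i g) + (lam - cK x) / i p * D j0 (i p) by rewrite -w0E; ring.
by apply: locD => //; apply: locM => //; rewrite lamE.
Qed.

(** The leading term h p' / (c p^(e+1)) of w_{j0} is matched by x dlog p, x being the constant
    residue, if e = 0, and by the derivative of -h / (e c p^e) otherwise. The extra denominator lies
    in A, so no new prime of positive degree appears. *)
Lemma reduce_pole (p g : {poly A}) w e : prime_elt p -> (1 < size p)%N -> ~ divides p g ->
  closed_form w -> (forall j, exists b, w j * i (p ^+ e.+1 * g) = i b) ->
  exists eta c, [/\ c != 0, log_exact eta,
    forall j, exists b, eta j * i (p ^+ e.+1 * (c%:P * g)) = i b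
    & loc i p (i p ^+ e * (w j0 - eta j0))].
Proof.
move=> pp szp npg cw dw.
have p0 : i p != 0 by rewrite i0; case: pp.
have g0 : i g != 0 := ndivides_neq0 i_inj npg.
case: e dw => [|e] dw.
  have [|x lx] := reduce_simple_pole pp szp npg cw; first by move=> j; have := dw j; rewrite expr1.
  exists (fun j => cK x * (D j (i p) / i p)), 1; split; rewrite ?oner_eq0 ?expr0 ?mul1r //.
    exact: log_exact_dlog.
  move=> j; have [a aE] := cKA x; have [q qE] := stable j p.
  exists (a%:P * q * g); rewrite expr1 !rmorphM -aE -qE.
  by field.
have [h [u [c [c0 wE]]]] := hermite_reduction pp szp npg dw.
have ic0 := iC0 c0.
have N0 : e.+1%:R != 0 :> A by exact: nat_neq0.
pose c' := e.+1%:R * c; have c'0 : c' != 0 by rewrite mulf_neq0.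
have ic'0 := iC0 c'0.
have ic'E : i c'%:P = e.+1%:R * i c%:P.
  by rewrite /c' polyCM rmorphM !rmorph_nat.
have iN0 : e.+1%:R != 0 :> L.
  by apply: contraNneq ic'0 => E; rewrite ic'E E mul0r.
clearbody c'; have [N NE] : exists N : L, N = e.+1%:R by exists e.+1%:R.
rewrite -NE in ic'E iN0.
pose Z := - (i h / i c'%:P).
pose W := Z / i p ^+ e.+1.
have dW j : D j W = (D j Z) / i p ^+ e.+1 - N * Z * D j (i p) / i p ^+ e.+2.
  rewrite /W Ddiv ?expf_neq0 // DX // !exprS -NE.
  by field; rewrite expf_neq0 // p0.
exists (fun j => D j W), (c' ^+ 2); split.
- by rewrite expf_neq0.
- exact: log_exact_d.
- move=> j; have [q qE] := stable j p; have [h' hE] := stable j h.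
  exists (p * (- (h' * c'%:P - h * (dA j c')%:P)) * g + e.+1%:R * h * q * c'%:P * g).
  have dZ : D j Z = - ((i h' * i c'%:P - i h * i (dA j c')%:P) / i c'%:P ^+ 2).
    by rewrite /Z DN // Ddiv // hE DA.
  rewrite dW dZ qE /Z expr2 polyCM !exprS !(rmorphD, rmorphN, rmorphM) rmorph_nat -NE !rmorphXn.
  rewrite /=; set P := i p ^+ e; have P0 : P != 0 by rewrite expf_neq0.
  by field; rewrite P0 p0 ic'0.
- have -> : i p ^+ e.+1 * (w j0 - D j0 W) = i u / (i c%:P * i g) - D j0 Z.
    rewrite wE dW Dj0; set dZ := D j0 Z; rewrite /Z ic'E !exprS.
    set P := i p ^+ e; have P0 : P != 0 by rewrite expf_neq0.
    by field; rewrite P0 p0 ic0 iN0 g0.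
  apply: locB => //.
    rewrite invfM mulrA; apply: locM => //; last exact: locV.
    by apply: locM => //; [exact: loc_i|apply: locV => //; exact: ndivides_polyC].
  apply: loc_der => //; apply: locN; apply: locM => //; first exact: loc_i.
  by apply: locV => //; exact: ndivides_polyC.
Qed.

(** Each turn lowers the exponent of a prime of positive degree in the denominator and adds only a
    factor in A, so the degree of [P] drops until [P] lies in A. *)
Lemma clear_denominators (P : {poly A}) w : P != 0 -> closed_form w ->
  (forall j, exists b, w j * i P = i b) ->
  exists w' c, [/\ c != 0, log_exact (fun j => w j - w' j), closed_form w'
    & forall j, exists b, w' j * i c%:P = i b].
Proof.
have [n] := ubnP (size P); elim: n P w => // n IHn P w szP P0 cw dw.
have [le|lt] := leqP (size P) 1.
  exists w, P`_0; split=> //.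
  - by rewrite -polyC_eq0 -size1_polyC.
  - by exists [::], 0; split=> // j; rewrite big_nil D0 // addr0 subrr.
  - by move=> j; rewrite -size1_polyC.
have [p [pp szp pP]] := prime_factor_size lt.
have [[|e] [g [npg PE]]] := factorial_prime_power fP pp P0.
  by case: npg; rewrite -[g]mul1r -(expr0 p) -PE.
have p0 : i p != 0 by rewrite i0; case: pp.
rewrite PE in dw.
have [eta [c [c0 le_eta deta leta]]] := reduce_pole pp szp npg cw dw.
have g0 : g != 0 by apply: contraNneq P0 => g0; rewrite PE g0 mulr0.
have cg0 : c%:P * g != 0 by rewrite mulf_neq0 // polyC_eq0.
have cwe : closed_form (fun j => w j - eta j) by apply: closed_formB => //; exact: log_exact_closed.
have dwe j : exists b, (w j - eta j) * i (p ^+ e.+1 * (c%:P * g)) = i b.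
  have [b bE] := dw j; have [b' b'E] := deta j.
  exists (b * c%:P - b'); rewrite mulrBl b'E rmorphB (rmorphM i b) -bE !rmorphM.
  by ring.
have lwe : forall j, loc i p (i p ^+ e * (w j - eta j)).
  apply: (loc_all pp szp cwe) => // j; have [b bE] := dwe j.
  by apply: frac_denominator bE; rewrite mulf_neq0 // expf_neq0 // -i0.
have [||//||w' [c' [c'0 le' cw' dw']]] := IHn (p ^+ e * (c%:P * g)) (fun j => w j - eta j).
- have p0' : p != 0 by case: pp.
  move: szP; rewrite PE exprS -mulrA mulrCA (mulrCA _ c%:P) mul_polyC size_scale //.
  rewrite (mulrCA _ p) size_mul ?mulf_neq0 ?expf_neq0 //.
  case: (size p) szp => [|[|k]] //= _; rewrite !addSn /= ltnS.
  by apply: leq_ltn_trans; rewrite leq_addl.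
- by rewrite mulf_neq0 // expf_neq0 //; case: pp.
- by move=> j; have [b bE] := dwe j; exact: (loc_denominator i_inj pp (lwe j) bE).
exists w', c'; split=> //.
apply: log_exact_trans le_eta.
by case: le' => s [u [s0 E]]; exists s, u; split=> // j; rewrite -E addrAC.
Qed.

(** The multiplier is the factorial of [size b], a common multiple of all the integers by which
    integration divides. *)
Lemma poly_antiderivative (b : {poly A}) : exists B n, B^`() = b * n.+1%:R.
Proof.
exists (\poly_(k < (size b).+1) (b`_k.-1 *+ ((size b)`! %/ k))), (size b)`!.-1.
rewrite prednK ?fact_gt0 //; apply/polyP => k.
rewrite coef_deriv coef_poly ltnS mulr_natr coefMn.
case: ltnP => [lt|le]; last by rewrite nth_default // !mul0rn.
by rewrite -mulrnA divnK // dvdn_fact.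
Qed.

(** Once the denominator lies in A, w_{j0} has an antiderivative W in the variable. Subtracting dW
    makes the component [j0] zero, and closedness then makes all the others constant in the
    variable. *)
Theorem eliminate_variable (P : {poly A}) w : P != 0 -> closed_form w ->
  (forall j, exists b, w j * i P = i b) ->
  exists w' c, [/\ c != 0, log_exact (fun j => w j - w' j), closed_form w'
    & forall j, exists a, w' j * i c%:P = i a%:P].
Proof.
move=> P0 cw dw; have [w1 [c [c0 le1 cw1 dw1]]] := clear_denominators P0 cw dw.
have [b bE] := dw1 j0; have [B [n BE]] := poly_antiderivative b.
pose c1 := c * n.+1%:R; have c10 : c1 != 0 by rewrite mulf_neq0 // nat_neq0.
have ic0 := iC0 c0; have ic10 := iC0 c10.
have ic1E : i c1%:P = i c%:P * n.+1%:R.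
  by rewrite /c1 polyCM rmorphM !rmorph_nat.
have in0 : n.+1%:R != 0 :> L by apply: contraNneq ic10 => E; rewrite ic1E E mulr0.
have [N NE] : exists N : L, N = n.+1%:R by exists n.+1%:R.
rewrite -NE in in0 ic1E; clearbody c1.
pose W := i B / i c1%:P.
have clw2 : closed_form (fun j => w1 j - D j W).
  by apply: closed_formB => //; exact/log_exact_closed/log_exact_d.
have w20 : w1 j0 - D j0 W = 0.
  rewrite /W Ddiv // !Dj0 derivC rmorph0 mulr0 subr0 BE rmorphM rmorph_nat -bE -NE ic1E.
  by field; rewrite in0 ic0.
exists (fun j => w1 j - D j W), (c1 ^+ 2); split=> //; first by rewrite expf_neq0.
  case: le1 => s [u [s0 E]]; exists s, (u + W); split=> // j.
  by rewrite DD // addrA -E opprB addrA addrAC.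
move=> j; have [b' b'E] := dw1 j; have [B' B'E] := stable j B.
pose b2 := b' * (n.+1%:R * c1%:P) - (B' * c1%:P - B * (dA j c1)%:P).
have b2E : (w1 j - D j W) * i (c1 ^+ 2)%:P = i b2.
  rewrite /b2 !(rmorphB, rmorphM) /= -b'E /W Ddiv // B'E DA rmorph_nat -NE.
  have -> : w1 j * i c%:P * (N * i c1%:P) = w1 j * (i c%:P * N) * i c1%:P by ring.
  by rewrite -ic1E; field.
exists (b2`_0); rewrite b2E; congr (i _); apply: deriv_eq0; apply: i_inj.
rewrite -Dj0 -b2E DM // Dj0 derivC rmorph0 mulr0 addr0 clw2 w20 D0 //.
by rewrite mul0r.
Qed.

End Elimination.
End Forms.

(** * Derivations on fraction fields *)

Lemma quotient_rule_add (F : fieldType) (a b c d a' b' c' d' : F) : b != 0 -> d != 0 ->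
  ((a' * d + a * d' + (c' * b + c * b')) * (b * d) - (a * d + c * b) * (b' * d + b * d'))
    / (b * d) ^+ 2 = (a' * b - a * b') / b ^+ 2 + (c' * d - c * d') / d ^+ 2.
Proof. by move=> b0 d0; field; rewrite b0 d0. Qed.

Lemma quotient_rule_mul (F : fieldType) (a b c d a' b' c' d' : F) : b != 0 -> d != 0 ->
  ((a' * c + a * c') * (b * d) - a * c * (b' * d + b * d')) / (b * d) ^+ 2
  = (a' * b - a * b') / b ^+ 2 * (c / d) + a / b * ((c' * d - c * d') / d ^+ 2).
Proof. by move=> b0 d0; field; rewrite b0 d0. Qed.

Section FractionDerivation.
Variables (R : idomainType) (delta : R -> R).
Hypothesis deltaD : forall a b, delta (a + b) = delta a + delta b.
Hypothesis deltaM : forall a b, delta (a * b) = delta a * b + a * delta b.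

Definition frac_der (x : {fraction R}) : {fraction R} :=
  let r := repr x in
  tofrac (delta \n_r * \d_r - \n_r * delta \d_r) / tofrac \d_r ^+ 2.

Lemma frac_derE x a b : b != 0 -> x * tofrac b = tofrac a ->
  frac_der x = tofrac (delta a * b - a * delta b) / tofrac b ^+ 2.
Proof.
move=> b0 E; rewrite /frac_der; have Ex := fraction_numden x; set r := repr x in Ex *.
have d0 : \d_r != 0 := denom_ratioP r.
have {}E : a * \d_r = \n_r * b.
  by apply/eqP; rewrite -tofrac_eq !tofracM -E -Ex mulrAC.
have E' : delta a * \d_r + a * delta \d_r = delta \n_r * b + \n_r * delta b.
  by rewrite -!deltaM E.
have fd0 : tofrac \d_r != 0 :> {fraction R} by rewrite tofrac_eq0.
have fb0 : tofrac b != 0 :> {fraction R} by rewrite tofrac_eq0.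
apply/eqP; rewrite eqr_div ?expf_neq0 //; apply/eqP.
rewrite -!tofracXn -!tofracM; congr tofrac.
transitivity (b * \d_r * (delta \n_r * b) - (\n_r * b) * b * delta \d_r); first by ring.
rewrite -E; transitivity (b * \d_r * (delta \n_r * b - a * delta \d_r)); first by ring.
have -> : delta \n_r * b - a * delta \d_r = delta a * \d_r - \n_r * delta b.
  by apply/eqP; rewrite subr_eq addrAC eq_sym subr_eq E'.
transitivity (b * \d_r * (delta a * \d_r) - (\n_r * b) * \d_r * delta b); first by ring.
by rewrite -E; ring.
Qed.

Lemma delta1 : delta 1 = 0.
Proof.
have := deltaM 1 1; rewrite !mulr1 mul1r => E.
by apply: (@addrI _ (delta 1)); rewrite -E addr0.
Qed.

Lemma frac_der_tofrac a : frac_der (tofrac a) = tofrac (delta a).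
Proof.
rewrite (@frac_derE _ a 1) ?oner_eq0 // ?tofrac1 ?mulr1 //.
by rewrite delta1 mulr0 subr0 expr1n invr1 mulr1.
Qed.

Lemma frac_derivation : derivation frac_der.
Proof.
split=> x y; have [a [b [b0 E]]] := fraction_repr x; have [c [d [d0 E']]] := fraction_repr y.
  have fb0 : tofrac b != 0 :> {fraction R} by rewrite tofrac_eq0.
  have fd0 : tofrac d != 0 :> {fraction R} by rewrite tofrac_eq0.
  rewrite (frac_derE b0 E) (frac_derE d0 E') (@frac_derE _ (a * d + c * b) (b * d)) ?mulf_neq0 //.
    rewrite deltaD !deltaM !(tofracB, tofracD, tofracM).
    exact: quotient_rule_add.
  by rewrite tofracD !tofracM -E -E'; ring.
have fb0 : tofrac b != 0 :> {fraction R} by rewrite tofrac_eq0.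
have fd0 : tofrac d != 0 :> {fraction R} by rewrite tofrac_eq0.
rewrite (frac_derE b0 E) (frac_derE d0 E') (@frac_derE _ (a * c) (b * d)) ?mulf_neq0 //.
  have -> : x = tofrac a / tofrac b by rewrite -E mulfK.
  have -> : y = tofrac c / tofrac d by rewrite -E' mulfK.
  rewrite !deltaM !(tofracB, tofracD, tofracM).
  exact: quotient_rule_mul.
by rewrite !tofracM -E -E'; ring.
Qed.

End FractionDerivation.

Lemma fraction_der_comm (R : idomainType) (d d' : {fraction R} -> {fraction R}) :
  derivation d -> derivation d' ->
  (forall a, d (d' (tofrac a)) = d' (d (tofrac a))) -> forall x, d (d' x) = d' (d x).
Proof.
move=> der der' comm x; have [a [b [b0 E]]] := fraction_repr x.
have fb0 : tofrac b != 0 :> {fraction R} by rewrite tofrac_eq0.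
have := comm a; rewrite -E !(derM der') !(derM der) (derD der) (derD der').
rewrite !(derM der') !(derM der) comm => /eqP; rewrite -subr_eq0 => /eqP E'.
apply: (mulIf fb0); apply/eqP; rewrite -subr_eq0 -E'; apply/eqP; ring.
Qed.

(** * Induction step from A to A[x] *)

Section LiftLevel.
Variables (K : closedFieldType) (L : fieldType) (cK : {rmorphism K -> L}).
Variables (J : finType) (D : J -> L -> L).
Hypothesis der : forall j, derivation (D j).

(** One stage of the tower K, K[X], K[X][Y], K[X][Y][Z], seen inside [L] with its derivations. *)
Record differential_level (A : idomainType) (iA : A -> L) (dA : J -> A -> A) : Prop := {
  level_inj : injective iA;
  level_factorial : factorial_ring A;
  level_nat_unit : forall n, (n.+1%:R : A) \is a GRing.unit;
  level_der : forall j a, D j (iA a) = iA (dA j a);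
  level_constants : forall c, exists a, cK c = iA a
}.

Definition exact_over (A : idomainType) (iA : A -> L) := forall w P, P != 0 ->
  closed_form D w -> (forall j, exists b, w j * iA P = iA b) -> log_exact cK D w.

Variables (A : idomainType) (iA : A -> L) (dA : J -> A -> A).
Variables (i : {rmorphism {poly A} -> L}) (j0 : J).
Hypothesis levA : differential_level iA dA.
Hypothesis iE : forall a, i a%:P = iA a.
Hypothesis DX : forall j, D j (i 'X) = (j == j0)%:R.
Hypothesis Dj0A : forall a, D j0 (iA a) = 0.

Definition lift_der j (P : {poly A}) := if j == j0 then P^`() else map_poly (dA j) P.

Let DA j a : D j (i a%:P) = i (dA j a)%:P.
Proof. by rewrite !iE (level_der levA). Qed.

Let iA_inj : injective (fun a => i a%:P).
Proof. by move=> a b; rewrite !iE => /(level_inj levA). Qed.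

Lemma lift_derE j P : D j (i P) = i (lift_der j P).
Proof.
have dA0 k : dA k 0 = 0.
  by apply: iA_inj; rewrite /= -DA polyC0 rmorph0 der0.
have dA00 k : map_poly (dA k) 0 = 0 by apply/polyP => m; rewrite coef_map_id0 // !coef0 dA0.
rewrite /lift_der; case: eqP => [->|/eqP nj].
  elim/poly_ind: P => [|P c IHP]; first by rewrite rmorph0 der0 // deriv0 rmorph0.
  rewrite derivD derivM derivX derivC mulr1 addr0 !rmorphD !rmorphM /=.
  by rewrite (derD (der _)) (derM (der _)) IHP DX eqxx iE Dj0A mulr1 addr0.
elim/poly_ind: P => [|P c IHP]; first by rewrite rmorph0 der0 // dA00 rmorph0.
have -> : map_poly (dA j) (P * 'X + c%:P) = map_poly (dA j) P * 'X + (dA j c)%:P.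
  apply/polyP => k; rewrite coef_map_id0 // !coefD !coefC !coefMX coef_map_id0 //.
  by case: k => [|k] /=; rewrite ?add0r ?addr0.
rewrite !rmorphD !rmorphM /= (derD (der _)) (derM (der _)) IHP DX (negPf nj) DA.
by rewrite mulr0 addr0.
Qed.

Lemma lift_der0 P : D j0 (i P) = i P^`().
Proof. by rewrite lift_derE /lift_der eqxx. Qed.

(** The derivations witness the independence of the new variable: if P maps to 0 then so does P', of
    smaller size; hence P' = 0 by induction and P is a constant in A. *)
Lemma lift_injective : injective i.
Proof.
have kerP P : i P = 0 -> P = 0.
  have [n] := ubnP (size P); elim: n P => // n IHn P szP iP.
  have [P0|P0] := eqVneq P 0; first by [].
  have dP : P^`() = 0.
    apply: IHn; first by rewrite -ltnS (leq_trans _ szP) // ltnS lt_size_deriv.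
    by rewrite -lift_der0 iP der0.
  have PE := deriv_eq0 (level_nat_unit levA) dP.
  by move: iP; rewrite PE -(rmorph0 i) -polyC0 => /iA_inj ->.
by move=> P Q /eqP; rewrite -subr_eq0 -rmorphB => /eqP/kerP/eqP; rewrite subr_eq0 => /eqP.
Qed.

Lemma lift_level : differential_level i lift_der.
Proof.
split; [exact: lift_injective|exact/factorial_poly/(level_factorial levA)| |exact: lift_derE|].
  by move=> n; rewrite -(rmorph_nat polyC) rmorph_unit // (level_nat_unit levA).
by move=> c; have [a ->] := level_constants levA c; exists a%:P.
Qed.

Hypothesis commD : forall j k x, D j (D k x) = D k (D j x).
Hypothesis DcK : forall j c, D j (cK c) = 0.
Hypothesis constK : forall x, (forall j, D j x = 0) -> exists c, x = cK c.

Lemma lift_exact : exact_over iA -> exact_over i.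
Proof.
move=> exA w P P0 cw dw.
have stable j Q : exists Q', D j (i Q) = i Q' by exists (lift_der j Q); exact: lift_derE.
have cKA c : exists a, cK c = i a%:P.
  by have [a ->] := level_constants levA c; exists a; rewrite iE.
have [w' [c [c0 lw cw' dw']]] := eliminate_variable der commD DcK constK
  lift_injective (level_factorial levA) (level_nat_unit levA) lift_der0 DA stable cKA P0 cw dw.
apply: (log_exact_trans der lw); apply: (exA _ c) => // j.
by have [a aE] := dw' j; exists a; rewrite -!iE.
Qed.

End LiftLevel.

(** The form with constant components c_j is the differential of sum_j c_j x_j. *)
Lemma constant_form_exact (K : closedFieldType) (L : fieldType) (cK : {rmorphism K -> L})
  (J : finType) (D : J -> L -> L) (x : J -> L) :
  (forall j, derivation (D j)) -> (forall j c, D j (cK c) = 0) ->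
  (forall j k, D j (x k) = (j == k)%:R) -> exact_over cK D cK.
Proof.
move=> der DcK Dx w P P0 cw dw; have cP0 : cK P != 0 by rewrite fmorph_eq0.
have wc j : exists b, w j == cK b.
  have [b bE] := dw j; exists (b / P); apply/eqP/(mulIf cP0).
  by rewrite -(rmorphM cK) divfK.
exists [::], (\sum_j cK (xchoose (wc j)) * x j); split=> [//|k].
rewrite big_nil add0r der_sum // (bigD1 k) //= big1 ?addr0 => [|j jk].
  rewrite (derM (der k)) DcK mul0r add0r Dx eqxx mulr1.
  exact/eqP/(xchooseP (wc k)).
by rewrite (derM (der k)) DcK mul0r add0r Dx eq_sym (negPf jk) mulr0.
Qed.

Lemma lift_der_eq0 (J : finType) (A : idomainType) (dA : J -> A -> A) j0 j P :
  j != j0 -> (forall a, dA j a = 0) -> lift_der dA j0 j P = 0.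
Proof.
move=> nj dA0; rewrite /lift_der (negPf nj).
by apply/polyP => k; rewrite coef_map_id0 // coef0.
Qed.

(** * Derivatives and poles of rational functions in three variables *)

Section MpolyChar0.
Variable (K : closedFieldType).
Hypothesis charK0 : [pchar K] =i pred0.
Local Notation R := {mpoly K[3]}.

Lemma natK_neq0 n : n.+1%:R != 0 :> K.
Proof. by have /pcharf0P -> := charK0. Qed.

Lemma mderiv_eq0_const (p : R) : (forall j, p^`M(j) = 0) -> p = (p@_0)%:MP.
Proof.
move=> dp; apply/mpolyP => m; rewrite mcoeffC.
have [->|m0] := eqVneq m 0%MM; first by rewrite mulr1.
rewrite mulr0.
have [j mj] : exists j, m j != 0%N.
  apply/existsP; rewrite -negb_forall; apply: contraNN m0 => /forallP mz.
  by apply/eqP/mnmP => j; rewrite mnm0E; apply/eqP.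
have /(congr1 (fun q : R => q@_(m - U_(j)))) := dp j.
rewrite mcoeff_mderiv mcoeff0 submK; last first.
  by apply/mnm_lepP => k; rewrite mnm1E; case: eqP => // <-; rewrite lt0n.
by move/eqP; rewrite -mulr_natr mulf_eq0 (negPf (natK_neq0 _)) orbF => /eqP.
Qed.

Lemma nat_unit_mpoly n : (n.+1%:R : R) \is a GRing.unit.
Proof. by rewrite -(rmorph_nat (@mpolyC 3 K)) rmorph_unit // unitfE natK_neq0. Qed.

Lemma mpoly_ndivides_msize (p q : R) : q != 0 -> (msize q < msize p)%N -> ~ divides p q.
Proof.
move=> q0 lt [c qE]; have c0 : c != 0 by apply: contraNneq q0 => c0; rewrite qE c0 mulr0.
have p0 : p != 0 by apply: contraNneq q0 => p0; rewrite qE p0 mul0r.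
move: lt; rewrite qE msizeM //; have := mpolySpred _ c0; have := mpolySpred _ p0.
by move=> _ Ec; rewrite (Ec mdeg) addnS /= ltnNge leq_addr.
Qed.

Lemma mderiv_msize j (p : R) : p != 0 -> (msize p^`M(j) < msize p)%N.
Proof.
move=> p0; rewrite (mpolySpred _ p0) ltnS msizeE; apply/bigmax_leqP_seq => m.
rewrite mcoeff_msupp mcoeff_mderiv => mp _.
have : (m + U_(j))%MM \in msupp p.
  by rewrite mcoeff_msupp; apply: contraNneq mp => ->; rewrite mul0rn.
by move/msize_mdeg_lt; rewrite mdegD mdeg1 addn1 (mpolySpred _ p0).
Qed.

Lemma mpoly_constant_unit (c : K) : c != 0 -> (c%:MP : R) \is a GRing.unit.
Proof. by move=> c0; rewrite rmorph_unit // unitfE. Qed.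

(** In characteristic 0 a nonconstant polynomial has a nonzero partial derivative, and its degree is
    too small for divisibility by [p]. *)
Lemma prime_derivative (p : R) : prime_elt p -> exists j, ~ divides p p^`M(j).
Proof.
move=> [p0 nu _]; apply: NNPP => no; case/negP: nu.
have dp j : p^`M(j) = 0.
  apply/eqP/negPn/negP => dj; apply: no; exists j.
  by apply: mpoly_ndivides_msize => //; exact: mderiv_msize.
move: p0; rewrite (mderiv_eq0_const dp) mpolyC_eq0; exact: mpoly_constant_unit.
Qed.

End MpolyChar0.

Section MpolyPoles.
Variable (K : closedFieldType).
Hypothesis charK0 : [pchar K] =i pred0.
Local Notation R := {mpoly K[3]}.
Variables (L : fieldType) (F : {rmorphism {mpoly K[3]} -> L}) (D : 'I_3 -> L -> L).
Hypothesis F_inj : injective F.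
Hypothesis F_frac : forall x, frac F x.
Hypothesis fR : factorial_ring {mpoly K[3]}.
Hypothesis der : forall j, derivation (D j).
Hypothesis DF : forall j p, D j (F p) = F p^`M(j).

Lemma loc_antiderivative_mpoly (p : R) n x : prime_elt p ->
  (forall j, loc F p (F p ^+ n.+1 * D j x)) -> loc F p (F p ^+ n * x).
Proof.
move=> pp lx; have [j nj] := prime_derivative charK0 pp.
apply: (loc_antiderivative F_inj pp (der j) _ (nat_unit_mpoly charK0) fR (DF j p)) => //.
- by move=> a; exists a^`M(j); exact: DF.
Qed.

(** A factorial ring is the intersection of its localizations at primes: the prime factors of a
    denominator are cancelled one at a time. *)
Lemma loc_everywhere x : (forall p, prime_elt p -> loc F p x) -> exists a, x = F a.
Proof.
move=> lx; have [a [b [b0 E]]] := F_frac x.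
have [u [s [uu ps bE]]] := fR b0; rewrite {b b0}bE in E.
elim: s a ps E => [|q s IHs] a ps E.
  exists (a * u^-1); rewrite rmorphM rmorphV //= -E big_nil mulr1.
  by rewrite mulfK // (i_eq0 F_inj); apply: contraTneq uu => ->; rewrite unitr0.
have pq : prime_elt q by apply: ps; rewrite mem_head.
have [||a' a'E] := @loc_denominator _ _ _ F_inj q pq x 0 a (u * \prod_(j <- s) j).
- by rewrite expr0 mul1r; exact: lx.
- have <- : u * \prod_(j <- q :: s) j = q ^+ 1 * (u * \prod_(j <- s) j) by rewrite big_cons mulrCA expr1.
  exact: E.
apply: (IHs a'); last by rewrite -a'E expr0 mul1r.
by move=> t ts; apply: ps; rewrite inE ts orbT.
Qed.

(** The derivatives, being 0, have no pole, so by integration [x] has none either; it is a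
    polynomial with zero derivatives. *)
Lemma der_constants x : (forall j, D j x = 0) -> exists c, x = F c%:MP.
Proof.
move=> dx; have [|a xE] := @loc_everywhere x.
  move=> p pp; rewrite -[x]mul1r -(expr0 (F p)); apply: loc_antiderivative_mpoly => // j.
  by rewrite dx mulr0; exact: loc0.
exists (a@_0); rewrite xE -mderiv_eq0_const // => j.
by apply: F_inj; rewrite -DF -xE dx rmorph0.
Qed.

End MpolyPoles.

(** * Closed rational forms in three variables *)

Section Rational.
Variable (K : closedFieldType).
Hypothesis charK0 : [pchar K] =i pred0.
Local Notation R := {mpoly K[3]}.
Local Notation L := {fraction {mpoly K[3]}}.
Local Notation F := (@tofrac R).

Definition pder (j : 'I_3) : L -> L := frac_der (fun p : R => p^`M(j)).
Definition constant : K -> L := F \o (@mpolyC 3 K).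
HB.instance Definition _ := GRing.RMorphism.on constant.

Lemma pder_derivation j : derivation (pder j).
Proof. by apply: frac_derivation => a b; rewrite ?mderivD ?mderivM. Qed.

Lemma pder_tofrac j (p : R) : pder j (F p) = F p^`M(j).
Proof. by apply: frac_der_tofrac => a b; rewrite mderivM. Qed.

Lemma pder_comm j k x : pder j (pder k x) = pder k (pder j x).
Proof.
apply: fraction_der_comm; try exact: pder_derivation.
by move=> a; rewrite !pder_tofrac mderiv_comm.
Qed.

Lemma pder_constant j c : pder j (constant c) = 0.
Proof. by rewrite /constant /= pder_tofrac mderivC tofrac0. Qed.

Lemma tofrac_inj : injective F.
Proof. by move=> x y /eqP; rewrite tofrac_eq => /eqP. Qed.


(** The three evaluations identify K[X][Y][Z] with the polynomials in three variables, one variable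
    at a time; injectivity will come from the derivations. *)
Definition eval1 : {rmorphism {poly K} -> R} :=
  horner_morph (fun c => mulrC (@varX K) (@mpolyC 3 K c)).
Definition eval2 : {rmorphism {poly {poly K}} -> R} :=
  horner_morph (fun c => mulrC (@varY K) (eval1 c)).
Definition eval3 : {rmorphism {poly {poly {poly K}}} -> R} :=
  horner_morph (fun c => mulrC (@varZ K) (eval2 c)).

Lemma pder_var j k : pder j (F 'X_k) = (j == k)%:R.
Proof.
rewrite pder_tofrac mderivX mnm1E eq_sym; case: eqP => [->|_]; last by rewrite scale0r tofrac0.
have -> : (U_(k) - U_(k))%MM = 0%MM by apply/mnmP => t; rewrite mnmBE mnm0E subnn.
by rewrite mpolyX0 scale1r tofrac1.
Qed.

Lemma level0 : differential_level constant pder constant (fun _ _ => 0).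
Proof.
split.
- exact: fmorph_inj.
- exact: factorial_field.
- by move=> n; rewrite unitfE (natK_neq0 charK0).
- by move=> j a; rewrite pder_constant /constant /= mpolyC0 tofrac0.
- by move=> c; exists c.
Qed.

Let ev1 : {rmorphism {poly K} -> L} := F \o eval1.
Let ev2 : {rmorphism {poly {poly K}} -> L} := F \o eval2.
Let ev3 : {rmorphism {poly {poly {poly K}}} -> L} := F \o eval3.

Lemma eval1C c : eval1 c%:P = c%:MP. Proof. exact: horner_morphC. Qed.
Lemma eval2C c : eval2 c%:P = eval1 c. Proof. exact: horner_morphC. Qed.
Lemma eval3C c : eval3 c%:P = eval2 c. Proof. exact: horner_morphC. Qed.
Lemma eval1X : eval1 'X = 'X_iX. Proof. exact: horner_morphX. Qed.
Lemma eval2X : eval2 'X = 'X_iY. Proof. exact: horner_morphX. Qed.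
Lemma eval3X : eval3 'X = 'X_iZ. Proof. exact: horner_morphX. Qed.

Let ev1C c : ev1 c%:P = constant c. Proof. exact: congr1 (eval1C c). Qed.
Let ev2C c : ev2 c%:P = ev1 c. Proof. exact: congr1 (eval2C c). Qed.
Let ev3C c : ev3 c%:P = ev2 c. Proof. exact: congr1 (eval3C c). Qed.

Let ev1X j : pder j (ev1 'X) = (j == iX)%:R.
Proof. by rewrite -(pder_var j iX) -eval1X. Qed.
Let ev2X j : pder j (ev2 'X) = (j == iY)%:R.
Proof. by rewrite -(pder_var j iY) -eval2X. Qed.
Let ev3X j : pder j (ev3 'X) = (j == iZ)%:R.
Proof. by rewrite -(pder_var j iZ) -eval3X. Qed.

Let der := pder_derivation.

Let level1 := lift_level der level0 ev1C ev1X (pder_constant iX).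

Let d1Y P : pder iY (ev1 P) = 0.
Proof.
by rewrite (lift_derE der level0 ev1C ev1X (pder_constant iX)) lift_der_eq0 // rmorph0.
Qed.

Let level2 := lift_level der level1 ev2C ev2X d1Y.

Let d2Z P : pder iZ (ev2 P) = 0.
Proof.
rewrite (lift_derE der level1 ev2C ev2X d1Y) lift_der_eq0 ?rmorph0 // => c.
exact: lift_der_eq0.
Qed.

Let level3 := lift_level der level2 ev3C ev3X d2Z.

Lemma eval3_surj (p : R) : exists P, eval3 P = p.
Proof.
pose im (q : R) := exists P, eval3 P = q.
have imC c : im c%:MP.
  by exists (c%:P%:P%:P); rewrite eval3C eval2C eval1C.
have imM q q' : im q -> im q' -> im (q * q').
  by move=> [P <-] [P' <-]; exists (P * P'); rewrite rmorphM.
have imD q q' : im q -> im q' -> im (q + q').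
  by move=> [P <-] [P' <-]; exists (P + P'); rewrite rmorphD.
have imX j : im 'X_j.
  case: j => -[|[|[|//]]] lt.
  - exists ('X%:P%:P); rewrite eval3C eval2C eval1X.
    by congr 'X_ _; apply: val_inj.
  - exists ('X%:P); rewrite eval3C eval2X.
    by congr 'X_ _; apply: val_inj.
  - exists 'X; rewrite eval3X.
    by congr 'X_ _; apply: val_inj.
have imXn q n : im q -> im (q ^+ n).
  move=> iq; elim: n => [|n IHn]; last by rewrite exprS; exact: imM.
  by rewrite expr0 -mpolyC1; exact: imC.
have imXm m : im 'X_[m].
  rewrite mpolyXE_id; apply: (big_ind im) => //; first by rewrite -mpolyC1; exact: imC.
  by move=> k _; exact: imXn.
elim/mpolyind: p => [|c m p _ _ imp]; first by rewrite -mpolyC0; exact: imC.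
by apply: imD => //; rewrite -mul_mpolyC; exact: imM.
Qed.

Lemma eval3_inj : injective eval3.
Proof. by move=> P Q PQ; apply: (level_inj level3); rewrite /ev3 /= PQ. Qed.

Lemma factorial_mpoly3 : factorial_ring R.
Proof.
have ex p : exists P, eval3 P == p by have [P <-] := eval3_surj p; exists P.
pose inv p := xchoose (ex p).
have invK : cancel inv eval3 by move=> p; exact/eqP/(xchooseP (ex p)).
have evK : cancel eval3 inv by move=> P; apply: eval3_inj; rewrite invK.
exact: factorial_transfer evK invK (level_factorial level3).
Qed.

Lemma pder_constants x : (forall j, pder j x = 0) -> exists c, x = constant c.
Proof.
exact: (der_constants charK0 tofrac_inj (@fraction_repr _) factorial_mpoly3 der pder_tofrac).
Qed.

Lemma exact0 : exact_over constant pder constant.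
Proof.
exact: (constant_form_exact der pder_constant pder_var).
Qed.

(** Starting from a common denominator of the three components, Z is eliminated, then Y, then X,
    which leaves a form with constant components. *)
Theorem closed_form_log_exact w : closed_form pder w -> log_exact constant pder w.
Proof.
move=> cw.
have ex3 := lift_exact der level2 ev3C ev3X d2Z pder_comm pder_constant pder_constants
  (lift_exact der level1 ev2C ev2X d1Y pder_comm pder_constant pder_constants
  (lift_exact der level0 ev1C ev1X (pder_constant iX) pder_comm pder_constant pder_constants exact0)).
have fr j : exists b, b != 0 /\ exists a, w j * F b = F a.
  by have [a [b [b0 E]]] := fraction_repr (w j); exists b; split=> //; exists a.
have [b0 [b00 [a0 E0]]] := fr iX; have [b1 [b10 [a1 E1]]] := fr iY.
have [b2 [b20 [a2 E2]]] := fr iZ.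
have [P PE] := eval3_surj (b0 * b1 * b2).
apply: (ex3 w P) => //.
  by apply: contraTneq isT => P0; move: PE; rewrite P0 rmorph0 => /esym/eqP; rewrite !mulf_eq0 (negPf b00) (negPf b10) (negPf b20).
have E j : exists q, w j * F (b0 * b1 * b2) = F q.
  rewrite !tofracM; case: j => -[|[|[|//]]] lt.
  - exists (a0 * b1 * b2); rewrite !tofracM -E0 !mulrA; congr (w _ * _ * _ * _).
    exact: val_inj.
  - exists (a1 * b0 * b2); rewrite !tofracM -E1 (mulrC (F b0)) !mulrA; congr (w _ * _ * _ * _).
    exact: val_inj.
  - exists (a2 * b0 * b1); rewrite !tofracM -E2 (mulrC (_ * _) (F b2)) !mulrA; congr (w _ * _ * _ * _).
    exact: val_inj.
move=> j; have [q qE] := E j; have [Q QE] := eval3_surj q.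
by exists Q; rewrite /= PE QE.
Qed.

End Rational.

(** * Logarithmic derivatives *)

Section Euler.
Variable (K : fieldType).
Local Notation R := {mpoly K[3]}.
Implicit Types (p q a : R).

Definition euler p : R := \sum_(j < 3) 'X_j * p^`M(j).

Lemma eulerD p q : euler (p + q) = euler p + euler q.
Proof. by rewrite -big_split; apply: eq_bigr => j _; rewrite mderivD mulrDr. Qed.

Lemma eulerZ c p : euler (c *: p) = c *: euler p.
Proof. by rewrite scaler_sumr; apply: eq_bigr => j _; rewrite mderivZ scalerAr. Qed.

Lemma eulerX (m : 'X_{1..3}) : euler 'X_[m] = 'X_[m] *+ mdeg m.
Proof.
rewrite mdegE -sumrMnr; apply: eq_bigr => j _; rewrite mderivX -scalerAr.
have [->|mj] := eqVneq (m j) 0%N; first by rewrite scale0r mulr0n.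
rewrite -mpolyXD scaler_nat; congr ('X_[_] *+ _).
apply/mnmP => k; rewrite mnmDE mnmBE mnm1E; case: eqP => [<-|_] /=; last by rewrite subn0.
by rewrite add1n subn1 prednK // lt0n.
Qed.

Lemma euler_coef p m : (euler p)@_m = p@_m *+ mdeg m.
Proof.
elim/mpolyind: p => [|c n p _ _ IHp].
  by rewrite /euler big1 ?mcoeff0 ?mul0rn // => j _; rewrite mderiv0 mulr0.
rewrite eulerD eulerZ eulerX !mcoeffD !mcoeffZ mcoeffMn mcoeffX IHp mulrnDl.
by case: eqP => [->|_]; rewrite ?mul0rn ?mulr0 ?mul0rn // mulrnAr.
Qed.

Lemma euler_homog p n : p \is n.-homog -> euler p = p *+ n.
Proof.
move=> hp; apply/mpolyP => m; rewrite euler_coef mcoeffMn.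
have [->//|mn] := eqVneq (mdeg m) n.
by rewrite (dhomog_nemf_coeff hp mn) !mul0rn.
Qed.

(** For n = 0 the derivative is 0, so the truncated predecessor does no harm. *)
Lemma mul_mderiv_homog a p m n j : a \is m.-homog -> p \is n.-homog ->
  a * p^`M(j) \is (m + n).-1.-homog.
Proof.
move=> ha hp.
have supp k : k \in msupp p^`M(j) -> (mdeg k).+1 = n.
  rewrite mcoeff_msupp mcoeff_mderiv => kp.
  have kj : (k + U_(j))%MM \in msupp p.
    by rewrite mcoeff_msupp; apply: contraNneq kp => ->; rewrite mul0rn.
  by have := dhomog_mf hp kj; rewrite /= mdegD mdeg1 addn1.
case: n hp supp => [|n] hp supp.
  have -> : p^`M(j) = 0.
    apply/eqP; rewrite -msupp_eq0; case: (msupp p^`M(j)) supp => // k s supp.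
    by have := supp k (mem_head _ _).
  by rewrite mulr0 dhomog0.
rewrite addnS; apply: dhomogM => //; apply/dhomogP => k /supp.
by case.
Qed.

End Euler.

Section LogDerivatives.
Variable (K : closedFieldType).
Hypothesis charK0 : [pchar K] =i pred0.
Local Notation R := {mpoly K[3]}.
Variables (L : fieldType) (F : {rmorphism {mpoly K[3]} -> L}) (D : 'I_3 -> L -> L).
Hypothesis F_inj : injective F.
Hypothesis F_frac : forall x, frac F x.
Hypothesis fR : factorial_ring {mpoly K[3]}.
Hypothesis der : forall j, derivation (D j).
Hypothesis DF : forall j p, D j (F p) = F p^`M(j).
Local Notation constant := (F \o @mpolyC 3 K).

Let F_eq0 p : (F p == 0) = (p == 0). Proof. exact: i_eq0. Qed.

Definition dlog j (x : L) := D j x / x.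

Lemma dlogM j x y : x != 0 -> y != 0 -> dlog j (x * y) = dlog j x + dlog j y.
Proof.
exact: (der_logM (der j)).
Qed.

Lemma dlogV j x : x != 0 -> dlog j x^-1 = - dlog j x.
Proof.
move=> x0; apply/eqP; rewrite -addr_eq0 -dlogM ?invr_eq0 // mulVf //.
by rewrite /dlog (der1 (der j)) mul0r.
Qed.

Lemma dlog1 j : dlog j 1 = 0.
Proof. by rewrite /dlog (der1 (der j)) mul0r. Qed.

Lemma dlogX j x n : x != 0 -> dlog j (x ^+ n) = dlog j x *+ n.
Proof.
move=> x0; elim: n => [|n IHn]; first by rewrite expr0 dlog1.
by rewrite exprS dlogM ?expf_neq0 // IHn mulrS.
Qed.

Lemma dlog_prod j (I : finType) (P : pred I) (x : I -> L) : (forall t, x t != 0) ->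
  dlog j (\prod_(t | P t) x t) = \sum_(t | P t) dlog j (x t).
Proof.
move=> x0; pose Q (y z : L) := y != 0 /\ dlog j y = z.
have [] // : Q (\prod_(t | P t) x t) (\sum_(t | P t) dlog j (x t)).
apply: (big_rec2 Q) => [|t z y _ [y0 <-]]; first by rewrite /Q oner_neq0 dlog1.
by rewrite /Q mulf_neq0 // dlogM.
Qed.

Lemma dlog_F j (p : R) : dlog j (F p) = F p^`M(j) / F p.
Proof. by rewrite /dlog DF. Qed.

Section AtPrime.
Variable p : R.
Hypothesis pp : prime_elt p.
Local Notation loc := (loc F p).

Let p0 : F p != 0. Proof. by rewrite F_eq0; case: pp. Qed.

Lemma loc_D j x : loc x -> loc (D j x).
Proof.
apply: (loc_der F_inj pp (der j)) => a.
by exists a^`M(j); exact: DF.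
Qed.

Lemma loc_constant c : loc (constant c).
Proof. exact: loc_i. Qed.

Lemma loc_dlog j q : ~ divides p q -> loc (dlog j (F q)).
Proof.
move=> nq; rewrite dlog_F; apply: locM => //; first exact: loc_i.
exact: (locV F_inj).
Qed.

(** [c] is the order of [x] along [p]: the exponent of [p] in a numerator minus that in the
    denominator, read in K. *)
Lemma dlog_order (x : L) : x != 0 ->
  exists c, forall j, loc (dlog j x - constant c * dlog j (F p)).
Proof.
move=> x0; have poly_case (a : R) : a != 0 ->
    exists k, forall j, loc (dlog j (F a) - constant k%:R * dlog j (F p)).
  move=> a0; have [k [g [ng aE]]] := factorial_prime_power fR pp a0.
  have g0 : F g != 0 := ndivides_neq0 F_inj ng.
  exists k => j; rewrite aE rmorphM rmorphXn dlogM ?expf_neq0 // dlogX //.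
  by rewrite rmorph_nat mulr_natl addrAC subrr add0r; exact: loc_dlog.
have [a [b [b0 E]]] := F_frac x.
have fb0 : F b != 0 by rewrite F_eq0.
have a0 : a != 0 by rewrite -(F_eq0 a) -E mulf_neq0.
have [k lk] := poly_case a a0; have [l ll] := poly_case b b0.
exists (k%:R - l%:R) => j.
have -> : x = F a * (F b)^-1 by rewrite -E mulfK.
rewrite dlogM ?invr_eq0 ?F_eq0 // dlogV // rmorphB.
set A := dlog j (F a); set B := dlog j (F b); set P := dlog j (F p).
have -> : A - B - (constant k%:R - constant l%:R) * P
    = (A - constant k%:R * P) - (B - constant l%:R * P).
  by ring.
by apply: (locB pp); [exact: lk|exact: ll].
Qed.

Lemma dlog_sum_order (s : seq (K * L)) : (forall t, t \in s -> t.2 != 0) ->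
  exists c, forall j, loc (\sum_(t <- s) constant t.1 * dlog j t.2 - constant c * dlog j (F p)).
Proof.
elim: s => [|t s IHs] s0.
  by exists 0 => j; rewrite big_nil rmorph0 mul0r subr0; exact: loc0.
have [|c lc] := IHs; first by move=> k ks; apply: s0; rewrite inE ks orbT.
have [|b lb] := @dlog_order t.2; first by apply: s0; rewrite mem_head.
exists (t.1 * b + c) => j; rewrite big_cons rmorphD rmorphM mulrDl opprD addrACA -mulrA -mulrBr.
by apply: locD => //; apply: locM => //; exact: loc_constant.
Qed.

(** The logarithmic part has at most a simple pole along [p], so the derivatives of [u] have order
    at most max(n, 1), and integration lowers this by one. For n = 0 the truncated [n.-1] is the
    right bound. *)
Lemma pole_order (w : 'I_3 -> L) (s : seq (K * L)) u n :
  (forall t, t \in s -> t.2 != 0) ->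
  (forall j, w j = \sum_(t <- s) constant t.1 * dlog j t.2 + D j u) ->
  (forall j, loc (F p ^+ n * w j)) -> loc (F p ^+ n.-1 * u).
Proof.
move=> s0 wE lw; have [c lc] := dlog_sum_order s0.
have lp : loc (F p) by exact: loc_i.
apply: loc_antiderivative_mpoly => // j.
have -> : D j u = w j - (\sum_(t <- s) constant t.1 * dlog j t.2 - constant c * dlog j (F p))
    - constant c * dlog j (F p).
  by rewrite wE; ring.
rewrite (mulrBr _ (w j - _)) (mulrBr _ (w j)); apply: locB => //; first apply: locB => //.
- case: n lw => [|n] lw //=; rewrite expr1; have := lw j; rewrite expr0 mul1r => lwj.
  exact: locM.
- by apply: locM => //; exact: locX.
- rewrite mulrCA /dlog exprSr -mulrA (mulrCA (F p)) divff // mulr1.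
  apply: (locM pp); first exact: loc_constant.
  apply: (locM pp); first exact: locX.
  by apply: loc_D; exact: loc_i.
Qed.

Lemma residue_unique c : (forall j, loc (constant c * dlog j (F p))) -> c = 0.
Proof.
move=> lc; apply/eqP/negPn/negP => c0.
have [j nj] := prime_derivative charK0 pp; apply: nj.
apply: (loc_divides F_inj pp).
have -> : F p^`M(j) / F p = constant c^-1 * (constant c * dlog j (F p)).
  by rewrite mulrA -rmorphM mulVf // rmorph1 mul1r dlog_F.
by apply: locM => //; exact: loc_constant.
Qed.

End AtPrime.

Lemma loc_associate (p q : R) x : prime_elt p -> prime_elt q -> divides p q ->
  loc F q x -> loc F p x.
Proof.
move=> pp pq pdq [a [b [nb E]]]; exists a, b; split=> // pb; apply: nb.
by apply: divides_trans pb; exact: prime_elt_sym.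
Qed.

(** Negative degree at infinity. As [msize] is the degree plus one, and 0 for the zero polynomial, 0
    is proper. *)
Definition proper (x : L) := exists a b : R, (msize a < msize b)%N /\ x * F b = F a.

Lemma msizeM_lt (a b c : R) : (msize a < msize b)%N -> c != 0 -> (msize (a * c) < msize (b * c))%N.
Proof.
move=> lt c0; have b0 : b != 0 by apply: contraTneq lt => ->; rewrite msize0.
rewrite (msizeM b0) // (mpolySpred mdeg c0) addnS /=.
have [->|a0] := eqVneq a 0.
  by rewrite mul0r msize0 (mpolySpred mdeg b0).
by rewrite msizeM // (mpolySpred mdeg c0) addnS /= ltn_add2r.
Qed.

Lemma properD x y : proper x -> proper y -> proper (x + y).
Proof.
move=> [a [b [ltab E]]] [c [d [ltcd E']]]; exists (a * d + c * b), (b * d).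
have b0 : b != 0 by apply: contraTneq ltab => ->; rewrite msize0.
have d0 : d != 0 by apply: contraTneq ltcd => ->; rewrite msize0.
split; last first.
  by rewrite rmorphD !rmorphM -E -E' mulrDl mulrA mulrAC; congr (_ + _); rewrite mulrA mulrAC.
apply: leq_ltn_trans (mmeasureD_le _ _ _) _; rewrite gtn_max msizeM_lt //=.
by rewrite (mulrC b) msizeM_lt.
Qed.

Lemma properZ c x : proper x -> proper (constant c * x).
Proof.
move=> [a [b [lt E]]]; exists (c *: a), b; split.
  have [->|c0] := eqVneq c 0; first by rewrite scale0r msize0 (leq_ltn_trans _ lt).
  by rewrite msizeZ.
by rewrite -mulrA E -mul_mpolyC rmorphM.
Qed.

Lemma proper0 : proper 0.
Proof. by exists 0, 1; rewrite mul0r rmorph0 msize0 msize1. Qed.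

Lemma proper_sum (I : eqType) (s : seq I) (x : I -> L) :
  (forall t, t \in s -> proper (x t)) -> proper (\sum_(t <- s) x t).
Proof.
elim: s => [|t s IHs] px; first by rewrite big_nil; exact: proper0.
rewrite big_cons; apply: properD; first by apply: px; rewrite mem_head.
by apply: IHs => k ks; apply: px; rewrite inE ks orbT.
Qed.

Lemma proper_dlog j x : x != 0 -> proper (dlog j x).
Proof.
move=> x0; have poly_case (a : R) : a != 0 -> proper (dlog j (F a)).
  move=> a0; exists a^`M(j), a; rewrite mderiv_msize //; split=> //.
  by rewrite dlog_F divfK // F_eq0.
have [a [b [b0 E]]] := F_frac x.
have fb0 : F b != 0 by rewrite F_eq0.
have a0 : a != 0 by rewrite -(F_eq0 a) -E mulf_neq0.
have -> : x = F a * (F b)^-1 by rewrite -E mulfK.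
rewrite dlogM ?invr_eq0 ?F_eq0 // dlogV //; apply: properD; first exact: poly_case.
have -> : - dlog j (F b) = constant (-1) * dlog j (F b) by rewrite rmorphN1 mulN1r.
exact/properZ/poly_case.
Qed.

Lemma proper_F (a : R) : proper (F a) -> a = 0.
Proof.
move=> [c [b [lt]]]; rewrite -rmorphM => /F_inj E.
apply/eqP/negPn/negP => a0; have b0 : b != 0 by apply: contraTneq lt => ->; rewrite msize0.
by move: lt; rewrite -E msizeM // (mpolySpred mdeg a0) /= ltnNge leq_addl.
Qed.

End LogDerivatives.

(** * The kernel of R(f) *)

Lemma big_ord3 (V : nmodType) (G : 'I_3 -> V) : \sum_(j < 3) G j = G iX + G iY + G iZ.
Proof.
rewrite !big_ord_recl big_ord0 addr0 addrA.
by congr (G _ + G _ + G _); apply: val_inj.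
Qed.

Lemma ord3P (j : 'I_3) : [\/ j = iX, j = iY | j = iZ].
Proof.
case: j => -[|[|[|//]]] lt; [apply: Or31|apply: Or32|apply: Or33]; exact: val_inj.
Qed.

Lemma prod_homog (K : fieldType) (n : nat) (I : finType) (P : pred I)
  (a : I -> {mpoly K[n]}) (m : I -> nat) :
  (forall t, a t \is (m t).-homog) -> \prod_(t | P t) a t \is (\sum_(t | P t) m t).-homog.
Proof.
move=> ha; apply: (big_rec2 (fun x y => x \is y.-homog)); first exact: dhomog1.
by move=> t x y _ hxy; exact: dhomogM.
Qed.

Section Kernel.
Variable (K : closedFieldType).
Hypothesis charK0 : [pchar K] =i pred0.
Local Notation R := {mpoly K[3]}.
Variables (L : fieldType) (F : {rmorphism {mpoly K[3]} -> L}) (D : 'I_3 -> L -> L).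
Hypothesis F_inj : injective F.
Hypothesis F_frac : forall x, frac F x.
Hypothesis fR : factorial_ring {mpoly K[3]}.
Hypothesis der : forall j, derivation (D j).
Hypothesis DF : forall j p, D j (F p) = F p^`M(j).
Hypothesis comm : forall j k x, D j (D k x) = D k (D j x).
Local Notation constant := (F \o @mpolyC 3 K).
Local Notation dlogD := (dlog D).

Let F_eq0 p : (F p == 0) = (p == 0). Proof. exact: i_eq0. Qed.

Variables (f : R) (d r : nat) (fs : 'I_r -> R) (e ds : 'I_r -> nat).
Hypothesis d_gt0 : (0 < d)%N.
Hypothesis f_homog : f \is d.-homog.
Hypothesis fs_prime : forall i, prime_elt (fs i).
Hypothesis fs_homog : forall i, fs i \is (ds i).-homog.
Hypothesis e_gt0 : forall i, (0 < e i)%N.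
Hypothesis fs_distinct : forall i j, i != j -> ~ divides (fs i) (fs j).
Hypothesis fE : f = \prod_(i < r) fs i ^+ e i.

Definition excess := (\sum_(i < r) ds i * (e i - 1))%N.
Definition gfac : R := \prod_(i < r) fs i ^+ (e i - 1).
Definition rad : R := \prod_(i < r) fs i.
Definition corad i : R := \prod_(k < r | k != i) fs k.

Let fs0 i : fs i != 0. Proof. by case: (fs_prime i). Qed.
Let Ffs0 i : F (fs i) != 0. Proof. by rewrite F_eq0. Qed.
Let e_sub i : e i = (e i - 1).+1. Proof. by rewrite subn1 prednK. Qed.

Lemma gfac_rad : f = gfac * rad.
Proof.
by rewrite fE -big_split; apply: eq_bigr => i _; rewrite {1}e_sub exprSr.
Qed.

Lemma rad_corad i : rad = fs i * corad i.
Proof. by rewrite /rad (bigD1 i). Qed.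

Lemma gfac_neq0 : gfac != 0.
Proof. by apply/prodf_neq0 => i _; rewrite expf_neq0. Qed.

Lemma rad_neq0 : rad != 0.
Proof. exact/prodf_neq0. Qed.

Lemma f_neq0 : f != 0.
Proof. by rewrite gfac_rad mulf_neq0 ?gfac_neq0 ?rad_neq0. Qed.

Let Ff0 : F f != 0. Proof. by rewrite F_eq0 f_neq0. Qed.
Let Fg0 : F gfac != 0. Proof. by rewrite F_eq0 gfac_neq0. Qed.
Let Fr0 : F rad != 0. Proof. by rewrite F_eq0 rad_neq0. Qed.

Lemma gfac_homog : gfac \is excess.-homog.
Proof. by apply: prod_homog => i; exact: dhomogMn. Qed.

Lemma rad_homog : rad \is (\sum_(i < r) ds i)%N.-homog.
Proof. exact: prod_homog. Qed.

Lemma degreeE : d = (excess + \sum_(i < r) ds i)%N.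
Proof.
apply: (dhomog_uniq f_neq0 f_homog); rewrite {1}gfac_rad.
exact: dhomogM gfac_homog rad_homog.
Qed.

Definition rad_dlog_gfac j : R := \sum_(i < r) (corad i * (fs i)^`M(j)) *+ (e i - 1).

(** This is f times the j-th derivative of h / gfac, a polynomial because f = gfac rad. *)
Definition exact_part j (h : R) : R := rad * h^`M(j) - h * rad_dlog_gfac j.

(* The numerator over [f] of the [j]-th component of [sum_i mu i * d(fs i) / fs i + d(h / gfac)]. *)
Definition numerator j (mu : 'I_r -> K) (h : R) : R :=
  \sum_(i < r) mu i *: (gfac * corad i * (fs i)^`M(j)) + exact_part j h.

Lemma dlog_gfac j : F rad * dlogD j (F gfac) = F (rad_dlog_gfac j).
Proof.
have -> : F gfac = \prod_(i < r) F (fs i) ^+ (e i - 1).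
  by rewrite rmorph_prod; apply: eq_bigr => i _; rewrite rmorphXn.
rewrite dlog_prod //; last by move=> i; rewrite expf_neq0.
rewrite mulr_sumr rmorph_sum; apply: eq_bigr => i _.
rewrite dlogX // rmorphMn rmorphM /= dlog_F // (rad_corad i) rmorphM mulrnAr.
by congr (_ *+ _); field.
Qed.

Lemma numeratorE j mu h : F (numerator j mu h) =
  F f * (\sum_(i < r) constant (mu i) * dlogD j (F (fs i)) + D j (F h / F gfac)).
Proof.
have -> : D j (F h / F gfac) = (F h^`M(j) - F h * dlogD j (F gfac)) / F gfac.
  by rewrite der_div // !DF /dlog DF; field.
rewrite /numerator /exact_part rmorphD mulrDr; congr (_ + _).
  rewrite rmorph_sum mulr_sumr; apply: eq_bigr => i _.
  rewrite -mul_mpolyC !rmorphM /= dlog_F // gfac_rad (rad_corad i) !rmorphM.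
  by field.
rewrite rmorphB !rmorphM -dlog_gfac {1}gfac_rad rmorphM.
by field.
Qed.

Lemma numerator_homog j mu h : h \is excess.-homog -> numerator j mu h \is (d.-1).-homog.
Proof.
move=> hh; have dE i : d = (excess + \sum_(k < r | k != i) ds k + ds i)%N.
  by rewrite degreeE [in LHS](bigD1 i) //= -addnA (addnC (ds i)).
have chom i : corad i \is (\sum_(k < r | k != i) ds k)%N.-homog by exact: prod_homog.
apply: rpredD; [|apply: rpredB].
- apply: rpred_sum => i _; apply: rpredZ; rewrite (dE i).
  by apply: mul_mderiv_homog => //; apply: dhomogM => //; exact: gfac_homog.
- rewrite degreeE addnC; apply: mul_mderiv_homog => //; exact: rad_homog.
- rewrite mulr_sumr; apply: rpred_sum => i _; rewrite mulrnAr; apply: rpredMn.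
  by rewrite mulrA (dE i); apply: mul_mderiv_homog => //; exact: dhomogM.
Qed.

(** Contraction with the Euler field. Each df_i contributes d_i f_i; the exact part contributes only
    as far as [h] fails to be homogeneous of degree [excess], since a quotient h / gfac of degree 0
    is killed. *)
Lemma numerator_euler mu h : \sum_(j < 3) 'X_j * numerator j mu h =
  (\sum_(i < r) mu i * (ds i)%:R) *: f + (rad * euler h - (h * rad) *+ excess).
Proof.
under eq_bigr do rewrite mulrDr.
rewrite big_split /=; congr (_ + _).
  under eq_bigr do rewrite mulr_sumr.
  rewrite exchange_big scaler_suml /=; apply: eq_bigr => i _.
  under eq_bigr => j _ do rewrite -scalerAr mulrCA.
  rewrite -scaler_sumr -mulr_sumr -/(euler (fs i)) (euler_homog (fs_homog i)).
  rewrite -scalerA scaler_nat; congr (_ *: _).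
  by rewrite mulrnAr gfac_rad (rad_corad i) -mulrA (mulrC (corad i)).
under eq_bigr do rewrite mulrBr.
rewrite big_split /=; congr (_ + _).
  by rewrite mulr_sumr; apply: eq_bigr => j _; rewrite mulrCA.
rewrite sumrN; congr (- _).
under eq_bigr => j _ do rewrite mulrCA mulr_sumr.
rewrite -mulr_sumr exchange_big /= -mulrnAr; congr (_ * _).
rewrite /excess -sumrMnr; apply: eq_bigr => i _.
under eq_bigr => j _ do rewrite mulrnAr mulrCA.
rewrite sumrMnl -mulr_sumr -/(euler (fs i)) (euler_homog (fs_homog i)) mulrnAr.
by rewrite (rad_corad i) mulrC mulrnA.
Qed.

Lemma log_form_closed mu h :
  closed_form D (fun j => F (numerator j mu h) / F f).
Proof.
have cl : closed_form D (fun j => \sum_(i < r) constant (mu i) * dlogD j (F (fs i)) + D j (F h / F gfac)).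
  apply: (@log_exact_closed K L constant _ D der comm).
    by move=> j c; rewrite /= DF mderivC rmorph0.
  exists [seq (mu i, F (fs i)) | i <- index_enum 'I_r], (F h / F gfac); split.
    by move=> t /mapP[i _ ->]; exact: Ffs0.
  by move=> j; rewrite big_map.
by move=> j k; rewrite !numeratorE ![F f * _]mulrC !mulfK //; exact: cl.
Qed.

Lemma RnumE (G H : R) :
  F (Rnum f G H) = F f ^+ 2 * (D iY (F G / F f) - D iX (F H / F f)).
Proof.
rewrite (der_div (der iY)) // (der_div (der iX)) // !DF /Rnum !(rmorphD, rmorphB, rmorphM).
by field.
Qed.

Lemma kerR_numerator mu h : \sum_(i < r) mu i * (ds i)%:R = 0 -> h \is excess.-homog ->
  kerR f d (numerator iX mu h, numerator iY mu h).
Proof.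
move=> mu0 hh; split; first split; rewrite ?numerator_homog //; first split; rewrite ?numerator_homog //.
  (* The contraction with the Euler field vanishes, so the quotient by Z is minus the third
     component. *)
  exists (- numerator iZ mu h); apply/eqP; rewrite -subr_eq0 mulrN opprK.
  rewrite -(big_ord3 (fun j => 'X_j * numerator j mu h)) numerator_euler mu0 scale0r add0r.
  by rewrite (euler_homog hh) mulrnAr mulrC subrr.
exists 0; split=> //; rewrite /Rval mulr0 /=; apply/eqP; rewrite -F_eq0 RnumE.
by rewrite (log_form_closed mu h iY iX) subrr mulr0.
Qed.

(** G / f is homogeneous of degree -1; [d_gt0] makes [d.-1] a true predecessor. *)
Lemma euler_quotient (G : R) : G \is (d.-1).-homog ->
  \sum_(k < 3) F 'X_k * D k (F G / F f) = - (F G / F f).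
Proof.
move=> hG; transitivity ((F (euler G) * F f - F G * F (euler f)) / F f ^+ 2).
  rewrite /euler !rmorph_sum mulr_suml mulr_sumr -sumrB mulr_suml; apply: eq_bigr => k _.
  by rewrite der_div // !DF !rmorphM; field.
rewrite (euler_homog hG) (euler_homog f_homog) !rmorphMn -[in F f *+ d](prednK d_gt0).
by rewrite -[F G *+ _]mulr_natr -[F f *+ _]mulr_natr -natr1; field.
Qed.

(** The third component is -Q, and R(f) = 0 reads D_X w_Y = D_Y w_X. Differentiating sum_j X_j w_j =
    0 in direction X and subtracting Euler's identity for w_X leaves Z (D_X w_Z - D_Z w_X) = 0;
    likewise for Y. *)
Lemma kerR_closed (G H : R) : kerR f d (G, H) -> exists a : 'I_3 -> R,
  [/\ a iX = G, a iY = H, \sum_(j < 3) 'X_j * a j = 0 & closed_form D (fun j => F (a j) / F f)].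
Proof.
move=> [[/= hG [hH [Q QE]]] [Q' [RQ Q'0]]].
have R0 : Rnum f G H = 0 by move: RQ; rewrite /Rval Q'0 mulr0.
pose a (j : 'I_3) := if j == iX then G else if j == iY then H else - Q.
have aS : \sum_(j < 3) 'X_j * a j = 0 by rewrite big_ord3 /a /= mulrN -/varX -/varY -/varZ QE subrr.
exists a; split=> //.
pose w j := F (a j) / F f; rewrite -/w.
have cXY : D iX (w iY) = D iY (w iX).
  apply/eqP; rewrite eq_sym -subr_eq0 -(mulrI_eq0 _ (mulfI (expf_neq0 2 Ff0))) -RnumE /= R0.
  by rewrite rmorph0.
have wS : \sum_(j < 3) F 'X_j * w j = 0.
  have := congr1 F aS; rewrite rmorph0 rmorph_sum => E.
  transitivity ((\sum_(j < 3) F ('X_j * a j)) / F f); last by rewrite E mul0r.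
  by rewrite mulr_suml; apply: eq_bigr => j _; rewrite rmorphM mulrA.
have eX := euler_quotient hG; have eY := euler_quotient hH.
rewrite -[F G / F f]/(w iX) in eX; rewrite -[F H / F f]/(w iY) in eY.
have DX (j k : 'I_3) : D j (F 'X_k) = (j == k)%:R.
  rewrite DF mderivX mnm1E eq_sym; case: eqP => [->|_]; last by rewrite scale0r rmorph0.
  have -> : (U_(k) - U_(k))%MM = 0%MM by apply/mnmP => t; rewrite mnmBE mnm0E subnn.
  by rewrite mpolyX0 scale1r rmorph1.
have contr k : w k + \sum_(j < 3) F 'X_j * D k (w j) = 0.
  have := congr1 (D k) wS; rewrite der0 // der_sum // => E; rewrite -[RHS]E.
  rewrite (bigD1 k) //= [in RHS](bigD1 k) //= (derM (der k)) DX eqxx mul1r -addrA.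
  congr (_ + (_ + _)); apply: eq_bigr => j jk.
  by rewrite (derM (der k)) DX eq_sym (negPf jk) mul0r add0r.
have FZ0 : F 'X_iZ != 0.
  rewrite F_eq0; apply/eqP => /(congr1 (fun p : R => p^`M(iZ))).
  by move/(congr1 F); rewrite -DF DX mderiv0 rmorph0 => /eqP; rewrite oner_eq0.
have cXZ : D iX (w iZ) = D iZ (w iX).
  apply: (mulfI FZ0); have := contr iX; rewrite big_ord3 cXY.
  move: eX; rewrite big_ord3 => eX E.
  transitivity (w iX + (F 'X_iX * D iX (w iX) + F 'X_iY * D iY (w iX) + F 'X_iZ * D iX (w iZ))
     - (F 'X_iX * D iX (w iX) + F 'X_iY * D iY (w iX) + F 'X_iZ * D iZ (w iX)) - w iX
     + F 'X_iZ * D iZ (w iX)); first by ring.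
  by rewrite E eX; ring.
have cYZ : D iY (w iZ) = D iZ (w iY).
  apply: (mulfI FZ0); have := contr iY; rewrite big_ord3 -cXY.
  move: eY; rewrite big_ord3 => eY E.
  transitivity (w iY + (F 'X_iX * D iX (w iY) + F 'X_iY * D iY (w iY) + F 'X_iZ * D iY (w iZ))
     - (F 'X_iX * D iX (w iY) + F 'X_iY * D iY (w iY) + F 'X_iZ * D iZ (w iY)) - w iY
     + F 'X_iZ * D iZ (w iY)); first by ring.
  by rewrite E eY; ring.
by move=> j k; case: (ord3P j) => ->; case: (ord3P k) => ->.
Qed.

Let loc_away p : prime_elt p -> (forall i, ~ divides p (fs i)) -> ~ divides p f.
Proof.
move=> pp np; rewrite fE.
apply: (big_ind (fun x => ~ divides p x)).
- by apply: prime_elt_ndiv_unit => //; exact: unitr1.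
- by move=> x y; exact: prime_elt_ndivM.
- by move=> i _; exact: prime_elt_ndivX.
Qed.

Lemma f_split i : exists c, ~ divides (fs i) c /\ f = fs i ^+ e i * c.
Proof.
exists (\prod_(k < r | k != i) fs k ^+ e k); split; last by rewrite fE (bigD1 i).
apply: (big_ind (fun x => ~ divides (fs i) x)).
- by apply: prime_elt_ndiv_unit => //; exact: unitr1.
- by move=> x y; exact: prime_elt_ndivM.
- by move=> k ki; apply: prime_elt_ndivX => //; apply: fs_distinct; rewrite eq_sym.
Qed.

Lemma loc_split x :
  (forall p, prime_elt p -> (forall i, ~ divides p (fs i)) -> loc F p x) ->
  (forall i, loc F (fs i) x) -> exists a, x = F a.
Proof.
move=> away at_; apply: (loc_everywhere F_inj F_frac fR) => p pp.
case: (classic (exists i, divides p (fs i))) => [[i pi]|no].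
  exact: loc_associate (fs_prime i) pi (at_ i).
by apply: away => // i pi; apply: no; exists i.
Qed.

Hypothesis all_exact : forall w, closed_form D w -> log_exact constant D w.

(** [h] is u gfac, a polynomial because [u] has a pole of order at most e_i - 1 along f_i and no
    other; mu_i is the residue along f_i. The given logarithmic part minus sum_i mu_i dlog f_i has
    no pole left, so it is a polynomial; having negative degree at infinity, it is 0. *)
Lemma log_form_structure (a : 'I_3 -> R) : closed_form D (fun j => F (a j) / F f) ->
  exists mu h, forall j, a j = numerator j mu h.
Proof.
move=> /all_exact[s [u [s0 wE]]]; pose w j := F (a j) / F f.
have {}wE j : w j = \sum_(t <- s) constant t.1 * dlogD j t.2 + D j u by exact: wE.
have w_away p : prime_elt p -> (forall i, ~ divides p (fs i)) -> forall j, loc F p (w j).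
  move=> pp np j; apply: (locM pp); first exact: loc_i.
  by apply: (locV F_inj) => //; exact: loc_away.
have u_away p : prime_elt p -> (forall i, ~ divides p (fs i)) -> loc F p u.
  move=> pp np; rewrite -[u]mul1r -(expr0 (F p)) -[0%N]/(0.-1)%N.
  apply: (pole_order charK0 F_inj F_frac fR der DF pp s0 wE) => j.
  by rewrite expr0 mul1r; exact: w_away.
have u_at i : loc F (fs i) (F (fs i) ^+ (e i - 1) * u).
  rewrite subn1; apply: (pole_order charK0 F_inj F_frac fR der DF (fs_prime i) s0 wE) => j.
  have [c [nc fc]] := f_split i.
  have c0 : F c != 0 := ndivides_neq0 F_inj nc.
  have -> : F (fs i) ^+ e i * w j = F (a j) * (F c)^-1.
    by rewrite /w fc rmorphM rmorphXn; field; rewrite c0 expf_neq0.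
  by apply: (locM (fs_prime i)); [exact: loc_i|exact: (locV F_inj)].
have [h hE] : exists h, F gfac * u = F h.
  apply: loc_split => [p pp np|i].
    by apply: (locM pp); [exact: loc_i|exact: u_away].
  rewrite /gfac (bigD1 i) //= rmorphM rmorphXn mulrAC; apply: (locM (fs_prime i)) => //.
  exact: loc_i.
have {}hE : u = F h / F gfac by rewrite -hE mulrC mulKf.
have [mu muP] : exists mu : 'I_r -> K, forall i j, loc F (fs i)
    (\sum_(t <- s) constant t.1 * dlogD j t.2 - constant (mu i) * dlogD j (F (fs i))).
  apply: (@fin_all_exists _ (fun=> K) (fun i c => forall j, loc F (fs i)
    (\sum_(t <- s) constant t.1 * dlogD j t.2 - constant c * dlogD j (F (fs i))))) => i.
  exact: (dlog_sum_order F_inj F_frac fR der DF (fs_prime i) s0).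
exists mu, h => j.
pose eta := \sum_(t <- s) constant t.1 * dlogD j t.2 - \sum_(i < r) constant (mu i) * dlogD j (F (fs i)).
have loc_term p i : prime_elt p -> ~ divides p (fs i) -> loc F p (constant (mu i) * dlogD j (F (fs i))).
  by move=> pp np; apply: (locM pp); [exact: loc_i|exact: loc_dlog].
have [n nE] : exists n, eta = F n.
  apply: loc_split => [p pp np|i].
    rewrite /eta; have -> : \sum_(t <- s) constant t.1 * dlogD j t.2 = w j - D j u by rewrite wE addrK.
    apply: (locB pp); first apply: (locB pp).
    - exact: w_away.
    - by apply: (loc_D F_inj der DF pp); exact: u_away.
    - by apply: (loc_sum pp) => i _; exact: loc_term.
  rewrite /eta (bigD1 i) //= opprD addrA; apply: (locB (fs_prime i)); first exact: muP.
  rewrite big_mkcond; apply: (loc_sum (fs_prime i)) => k _.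
  by case: ifP => [ki|_]; [apply: loc_term => //; apply: fs_distinct; rewrite eq_sym|exact: loc0].
have n0 : n = 0.
  apply: (proper_F F_inj); rewrite -nE.
  have pconst (c : K) x : proper F x -> proper F (constant c * x) by exact: properZ.
  rewrite /eta -mulN1r -(rmorphN1 constant); apply: properD => //.
    by apply: proper_sum => t ts; apply: (pconst); apply: proper_dlog => //; exact: s0.
  by apply: (pconst); apply: proper_sum => i _; apply: (pconst); exact: proper_dlog.
apply: F_inj; rewrite numeratorE -hE.
have -> : \sum_(i < r) constant (mu i) * dlogD j (F (fs i)) = \sum_(t <- s) constant t.1 * dlogD j t.2.
  by apply/esym/eqP; rewrite -subr_eq0 -/eta nE n0 rmorph0.
by rewrite -wE /w mulrC divfK.
Qed.

Lemma homog0_constant (p : R) : p \is 0.-homog -> p = (p@_0)%:MP.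
Proof.
move=> hp; apply/mpolyP => m; rewrite mcoeffC.
have [->|m0] := eqVneq m 0%MM; first by rewrite mulr1.
by rewrite mulr0 (dhomog_nemf_coeff hp) //= mdeg_eq0.
Qed.

Lemma ds_gt0 i : (0 < ds i)%N.
Proof.
rewrite lt0n; apply/eqP => di; have := fs_homog i; rewrite di => /homog0_constant E.
have [p0 /negP nu _] := fs_prime i; apply: nu; rewrite E; apply: mpoly_constant_unit.
by apply: contraNneq p0 => c0; rewrite E c0 mpolyC0.
Qed.

Lemma r_gt0 : (0 < r)%N.
Proof.
case: (posnP r) => // r0; move: d_gt0; rewrite degreeE /excess !big1 // => i _.
  by move: (ltn_ord i); rewrite {2}r0.
by move: (ltn_ord i); rewrite {2}r0.
Qed.

Lemma exact_partD j h h' : exact_part j (h + h') = exact_part j h + exact_part j h'.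
Proof. by rewrite /exact_part mderivD; ring. Qed.

Lemma exact_partZ j c h : exact_part j (c *: h) = c *: exact_part j h.
Proof. by rewrite /exact_part mderivZ -scalerAr -scalerAl scalerBr. Qed.

Lemma exact_part_homog j h m : h \is m.-homog ->
  exact_part j h \is (\sum_(i < r) ds i + m)%N.-1.-homog.
Proof.
move=> hh; apply: rpredB; first by apply: mul_mderiv_homog => //; exact: rad_homog.
rewrite mulr_sumr; apply: rpred_sum => i _; rewrite mulrnAr; apply: rpredMn.
rewrite mulrA (bigD1 i) //= -addnA addnC addnAC addnC addnA.
rewrite -addnA [X in _ \is X.-1.-homog]addnCA addnA.
apply: mul_mderiv_homog => //; rewrite addnC; apply: dhomogM => //; exact: prod_homog.
Qed.

(** [exact_part] raises degrees by sum_i d_i - 1, and d = excess + sum_i d_i. *)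
Lemma exact_part_pihomog j h :
  pihomog mdeg d.-1 (exact_part j h) = exact_part j (pihomog mdeg excess h).
Proof.
have ex0 : exact_part j 0 = 0 by rewrite /exact_part mderiv0 mulr0 mul0r subrr.
have exS n (G : 'I_n -> R) : exact_part j (\sum_(k < n) G k) = \sum_(k < n) exact_part j (G k).
  exact: (big_morph _ (exact_partD j) ex0).
(* Hence the predecessor is never truncated, and components of [h] of distinct degrees keep distinct
   degrees. *)
have ds1 : (0 < \sum_(i < r) ds i)%N.
  by rewrite (bigD1 (Ordinal r_gt0)) //= addn_gt0 ds_gt0.
rewrite {1}(pihomog_partitionE (leqnn (mmeasure mdeg h))) exS raddf_sum /=.
rewrite [in RHS](pihomog_partitionE (leqnn (mmeasure mdeg h))) raddf_sum /= exS.
apply: eq_bigr => k _; have hk := pihomogP mdeg k h.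
have ek := exact_part_homog j hk.
have [kE|kN] := eqVneq (k : nat) excess.
  by rewrite -kE pihomog_id pihomog_dE // degreeE addnC -kE.
rewrite (pihomog_ne0 kN hk) ex0; apply: (pihomog_ne0 _ ek).
by move/eqP: kN ds1; rewrite degreeE; set S := (\sum_(i < r) _)%N; move=> kN S0; apply/eqP; lia.
Qed.

Lemma numeratorD0 j mu h : numerator j mu h = numerator j mu 0 + exact_part j h.
Proof. by rewrite /numerator {2}/exact_part mderiv0 mulr0 mul0r subrr addr0. Qed.

Lemma numerator_linear j c mu mu' h h' :
  numerator j (fun i => c * mu i + mu' i) (c *: h + h')
  = c *: numerator j mu h + numerator j mu' h'.
Proof.
rewrite /numerator; have -> : \sum_(i < r) (c * mu i + mu' i) *: (gfac * corad i * (fs i)^`M(j))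
    = c *: (\sum_(i < r) mu i *: (gfac * corad i * (fs i)^`M(j)))
      + \sum_(i < r) mu' i *: (gfac * corad i * (fs i)^`M(j)).
  rewrite (scaler_sumr c) -big_split; apply: eq_bigr => i _.
  by rewrite scalerDl scalerA.
by rewrite [in RHS]scalerDr [RHS]addrACA exact_partD exact_partZ.
Qed.

Lemma eq_numerator j mu mu' h : mu =1 mu' -> numerator j mu h = numerator j mu' h.
Proof. by move=> E; congr (_ + _); apply: eq_bigr => i _; rewrite E. Qed.

Lemma numerator_gfac j mu : (forall i, mu i = 0) -> numerator j mu gfac = 0.
Proof.
move=> mu0; apply: F_inj; rewrite numeratorE divff // der1 // addr0 rmorph0 big1 ?mulr0 //.
by move=> i _; rewrite mu0 rmorph0 mul0r.
Qed.

(** The [h] obtained from the form need not be homogeneous; as G and H have degree d - 1, only its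
    component of degree [excess] contributes to them. *)
Lemma kerR_structure (G H : R) : kerR f d (G, H) -> exists mu h,
  [/\ \sum_(i < r) mu i * (ds i)%:R = 0, h \is excess.-homog,
      G = numerator iX mu h & H = numerator iY mu h].
Proof.
move=> kGH; have [[/= hG [hH _]] _] := kGH.
have [a [aX aY aS ca]] := kerR_closed kGH.
have [mu [h ah]] := log_form_structure ca.
exists mu, (pihomog mdeg excess h).
have proj j : a j \is d.-1.-homog -> a j = numerator j mu (pihomog mdeg excess h).
  move=> haj; rewrite -(pihomog_dE haj) ah (numeratorD0 j mu h) raddfD /=.
  rewrite exact_part_pihomog [RHS]numeratorD0 pihomog_dE //.
  by apply: numerator_homog; exact: dhomog0.
split; [|exact: pihomogP|by rewrite -proj ?aX|by rewrite -proj ?aY].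
have : \sum_(j < 3) 'X_j * numerator j mu h = 0.
  by rewrite -[RHS]aS; apply: eq_bigr => j _; rewrite ah.
rewrite numerator_euler; set c := \sum_(i < r) _ => E.
have {E} E : rad * (c *: gfac + (euler h - h *+ excess)) = 0.
  by rewrite mulrDr -scalerAr mulrBr mulrnAr (mulrC _ gfac) -gfac_rad (mulrC _ h).
move/eqP: E; rewrite mulf_eq0 (negPf rad_neq0) /= => /eqP E.
(* Coefficients are compared at a monomial of [gfac]. Its degree is [excess], where euler h - h *+
   excess has zero coefficient; so [c] times a nonzero coefficient is 0. *)
have mg := mlead_supp gfac_neq0.
have := congr1 (fun p : R => p@_(mlead gfac)) E.
rewrite /= mcoeff0 mcoeffD mcoeffZ mcoeffB euler_coef mcoeffMn (dhomog_mf gfac_homog mg).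
by rewrite subrr addr0 => /eqP; rewrite mulf_eq0 mleadc_eq0 (negPf gfac_neq0) orbF => /eqP.
Qed.

(** The contraction makes the third component vanish as well. A zero form has zero residues, so
    every mu_i is 0; then h / gfac has zero derivatives and is a constant. *)
Lemma numerator_eq0 mu h : \sum_(i < r) mu i * (ds i)%:R = 0 -> h \is excess.-homog ->
  numerator iX mu h = 0 -> numerator iY mu h = 0 ->
  (forall i, mu i = 0) /\ exists c, h = c *: gfac.
Proof.
move=> mu0 hh nX nY.
have nZ : numerator iZ mu h = 0.
  have := numerator_euler mu h; rewrite mu0 scale0r add0r (euler_homog hh) mulrnAr mulrC subrr.
  rewrite big_ord3 nX nY !mulr0 !add0r => /eqP; rewrite mulf_eq0 => /orP[/eqP Z0|/eqP //].
  have /eqP := congr1 (fun p : R => p@_U_(iZ)) Z0.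
  by rewrite /= mcoeffX eqxx mcoeff0 oner_eq0.
have n0 j : numerator j mu h = 0 by case: (ord3P j) => ->.
pose u := F h / F gfac.
have E j : \sum_(i < r) constant (mu i) * dlogD j (F (fs i)) + D j u = 0.
  by apply: (mulfI Ff0); rewrite -numeratorE n0 rmorph0 mulr0.
have muz i : mu i = 0.
  apply: (residue_unique charK0 F_inj DF (fs_prime i)) => j.
  have lu : loc F (fs i) u.
    rewrite -[u]mul1r -(expr0 (F (fs i))) -[0%N]/(1.-1)%N.
    apply: (@pole_order K charK0 L F D F_inj F_frac fR der DF (fs i) (fs_prime i) (fun=> 0)
       [seq (mu k, F (fs k)) | k <- index_enum 'I_r] u 1) => [t /mapP[k _ ->]|k|k].
    - exact: Ffs0.
    - by rewrite big_map E.
    - by rewrite mulr0; exact: loc0.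
  have -> : constant (mu i) * dlogD j (F (fs i))
      = - (\sum_(k < r | k != i) constant (mu k) * dlogD j (F (fs k)) + D j u).
    by apply/eqP; rewrite -addr_eq0 addrA -(bigD1 i (P := xpredT)) //= E.
  apply: locN; apply: (locD (fs_prime i)); last exact: (loc_D F_inj der DF (fs_prime i)).
  rewrite big_mkcond; apply: (loc_sum (fs_prime i)) => k _.
  case: ifP => [ki|_]; last exact: loc0.
  apply: (locM (fs_prime i)); first exact: loc_i.
  by apply: loc_dlog => //; apply: fs_distinct; rewrite eq_sym.
split=> //.
have [|c uE] := @der_constants K charK0 L F D F_inj F_frac fR der DF u.
  move=> j; have := E j; rewrite big1 ?add0r // => i _.
  by rewrite muz rmorph0 mul0r.
exists c; apply: F_inj; rewrite -mul_mpolyC rmorphM -uE /u divfK //.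
Qed.

End Kernel.

(** * Dimension count *)

Section HasDim.
Variables (K : fieldType) (U : vectType K) (phi1 phi2 : U -> {mpoly K[3]}).
Hypotheses (lin1 : linear phi1) (lin2 : linear phi2).

Lemma linear_sum_scale (V : lmodType K) (phi : U -> V) (n : nat) (c : 'I_n -> K) (x : 'I_n -> U) :
  linear phi -> phi (\sum_(i < n) c i *: x i) = \sum_(i < n) c i *: phi (x i).
Proof.
move=> lin; have phi0 : phi 0 = 0.
  have := lin 1 0 0; rewrite !scale1r addr0 => E.
  by apply: (@addrI _ (phi 0)); rewrite addr0 -E.
apply: (big_rec2 (fun a b => phi a = b)) => // i a b _ <-.
exact: lin.
Qed.

(** A complement of the line of [w0] in [W] is mapped bijectively onto [S], and its basis to a
    basis. *)
Lemma has_dim_image (S : {mpoly K[3]} * {mpoly K[3]} -> Prop) (W : {vspace U}) (w0 : U) :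
  (forall u, u \in W -> S (phi1 u, phi2 u)) ->
  (forall v, S v -> exists2 u, u \in W & v = (phi1 u, phi2 u)) ->
  w0 != 0 -> w0 \in W -> phi1 w0 = 0 -> phi2 w0 = 0 ->
  (forall u, u \in W -> phi1 u = 0 -> phi2 u = 0 -> u \in <[w0]>%VS) ->
  exists n, has_dim S n /\ n.+1 = \dim W.
Proof.
move=> SW surj w00 w0W p1 p2 ker; pose W' := (W :\: <[w0]>)%VS.
have W'W u : u \in W' -> u \in W by apply: subvP; exact: diffvSl.
have w0sub : (<[w0]> <= W)%VS by rewrite -memvE.
exists (\dim W'); split; last first.
  by have := dimv_cap_compl W <[w0]>%VS; rewrite (capv_idPr w0sub) dim_vline w00.
pose b (i : 'I_(\dim W')) := (vbasis W')`_i.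
have bW' i : b i \in W' by rewrite /b vbasis_mem // mem_nth // size_tuple.
exists (fun i => (phi1 (b i), phi2 (b i))); split; [|split].
- by move=> i; apply/SW/W'W.
- move=> c; rewrite /lincomb /= -!linear_sum_scale // => -[E1 E2].
  have sW' : \sum_(i < \dim W') c i *: b i \in W'.
    by apply: memv_suml => i _; apply: memvZ.
  have : \sum_(i < \dim W') c i *: b i \in (W' :&: <[w0]>)%VS.
    by rewrite memv_cap sW' ker // W'W.
  rewrite capv_diff memv0 => /eqP; apply/freeP.
  exact: basis_free (vbasisP W').
- move=> v /surj[u uW ->].
  have : u \in (W' + <[w0]>)%VS by rewrite addv_diff (addv_idPl w0sub).
  move=> /memv_addP[x xW' [_ /vlineP[k ->] uE]].
  have uX phi : linear phi -> phi w0 = 0 -> phi u = phi x :> {mpoly K[3]}.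
    by move=> lin p0; rewrite uE addrC lin p0 scaler0 add0r.
  exists (fun i => coord (vbasis W') i x).
  by rewrite /lincomb /= -!linear_sum_scale // -(coord_vbasis xW') !uX.
Qed.

End HasDim.

Section WeightKernel.
Variables (K : fieldType) (r s : nat) (ds : 'I_r -> nat).
Local Notation U := ('rV[K]_r * dhomog 3 K s)%type.

Definition weight (u : U) : K^o := \sum_(i < r) u.1 0 i * (ds i)%:R.

Lemma weight_linear : linear weight.
Proof.
move=> c u v; rewrite /weight scaler_sumr -big_split; apply: eq_bigr => i _ /=.
by rewrite !mxE mulrDl -mulrA.
Qed.

HB.instance Definition _ := GRing.isLinear.Build K U K^o _ weight weight_linear.

Definition weight_kernel : {vspace U} := lker (linfun weight).

Lemma mem_weight_kernel u : (u \in weight_kernel) = (weight u == 0).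
Proof. by rewrite memv_ker lfunE. Qed.

(** Rank-nullity for a nonzero linear form; there are C(s+2, s) = C(s+2, 2) monomials of degree s in
    three variables. *)
Lemma dim_weight_kernel i0 : (ds i0)%:R != 0 :> K ->
  (\dim weight_kernel).+1 = (r + 'C(s + 2, 2))%N.
Proof.
move=> di; have := limg_ker_dim (linfun weight) fullv; rewrite capfv.
have -> : \dim {:U} = (r + 'C(s + 2, 2))%N.
  rewrite dimvf -[X in 'C(_, X)](addKn s 2) bin_sub ?leq_addr //.
  by rewrite -[X in (X + _)%N]mul1n.
suff -> : \dim (linfun weight @: fullv) = 1%N by rewrite addn1.
apply/eqP; rewrite eqn_leq; apply/andP; split.
  by have := dimvS (subvf (linfun weight @: fullv)%VS); rewrite dimvf.
pose u : U := (\row_i (i == i0)%:R, 0).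
have wu : weight u != 0.
  rewrite /weight (bigD1 i0) //= mxE eqxx mul1r big1 ?addr0 // => i ii0.
  by rewrite mxE (negPf ii0) mul0r.
rewrite lt0n dimv_eq0; apply: contraNneq wu => im0.
have : linfun weight u \in (linfun weight @: fullv)%VS by apply: memv_img; exact: memvf.
by rewrite im0 memv0 lfunE.
Qed.

End WeightKernel.

Lemma mpoly_unit_constant (K : fieldType) (p : {mpoly K[3]}) :
  p \is a GRing.unit -> p = (p@_0)%:MP.
Proof. by move=> /andP[/eqP]. Qed.

Theorem theorem1p8 (K : closedFieldType) (charK0 : [pchar K] =i pred0)
  (f : {mpoly K[3]}) (d : nat) (r : nat) (fs : 'I_r -> {mpoly K[3]})
  (e ds : 'I_r -> nat) :
  (1 <= d)%N -> f \is d.-homog ->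
  (forall i, mirreducible (fs i)) ->
  (forall i, fs i \is (ds i).-homog) ->
  (forall i, (0 < e i)%N) ->
  (forall i j, i != j -> ~ exists c : K, fs i = c *: fs j) ->
  f = \prod_(i < r) fs i ^+ e i ->
  exists n : nat, has_dim (kerR f d) n /\
    (n%:Z = r%:Z - 2 + ('C(2 + \sum_(i < r) ds i * (e i - 1), 2))%:Z) /\
    (mirreducible f <-> n = 0%N).
Proof.
move=> d_gt0 f_homog fs_irr fs_homog e_gt0 fs_np fE.
have fR := factorial_mpoly3 charK0.
have fs_prime i : prime_elt (fs i).
  by have [f0 [nu irr]] := fs_irr i; exact: factorial_irreducible_prime.
(* The cofactor would be a unit, hence a constant, and the two primes would be proportional. *)
have fs_distinct i j : i != j -> ~ divides (fs i) (fs j).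
  move=> ij [c cE]; have [_ [_ irr]] := fs_irr j.
  have [ui|/mpoly_unit_constant cC] := irr _ _ cE.
    by have [_ []] := fs_irr i; rewrite ui.
  apply: (fs_np j i); first by rewrite eq_sym.
  by exists (c@_0); rewrite cE {1}cC mulrC mul_mpolyC.
pose F : {rmorphism {mpoly K[3]} -> {fraction {mpoly K[3]}}} := @tofrac {mpoly K[3]}.
have F_inj : injective F := @tofrac_inj K.
have F_frac x : frac F x := fraction_repr x.
have der := @pder_derivation K.
have DF := @pder_tofrac K.
have comm := @pder_comm K.
have all_exact := @closed_form_log_exact K charK0.
pose s := excess e ds.
have r0 : (0 < r)%N := r_gt0 d_gt0 f_homog fs_prime fs_homog e_gt0 fE.
have ds0 i : (0 < ds i)%N := ds_gt0 fs_prime fs_homog i.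
pose i0 := Ordinal r0.
have dsK i : (ds i)%:R != 0 :> K by rewrite -(prednK (ds0 i)) natK_neq0.
have gh : gfac fs e \is s.-homog := gfac_homog e fs_homog.
have g0 : gfac fs e != 0 := gfac_neq0 e fs_prime.
pose phi j (u : 'rV[K]_r * dhomog 3 K s) := numerator fs e j (fun i => u.1 0 i) (u.2 : {mpoly K[3]}).
have lin_phi j : linear (phi j).
  by move=> c u v; rewrite -numerator_linear; apply: eq_numerator => i; rewrite !mxE.
pose W := weight_kernel K s ds.
have WP u : u \in W -> \sum_(i < r) u.1 0 i * (ds i)%:R = 0.
  by rewrite mem_weight_kernel => /eqP.
(* This pair stands for d(gfac / gfac) = 0 and spans the kernel of the parametrization. *)
pose w0 : 'rV[K]_r * dhomog 3 K s := (0, DHomog gh).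
have w0W : w0 \in W.
  by rewrite mem_weight_kernel /weight big1 // => i _; rewrite mxE mul0r.
have phi_w0 j : phi j w0 = 0.
  apply: (numerator_gfac F_inj der DF fs_prime e_gt0 fE) => i; exact: mxE.
have [||||n [dimn nW]] := @has_dim_image _ _ (phi iX) (phi iY) (lin_phi iX) (lin_phi iY)
  (kerR f d) W w0 _ _ _ w0W (phi_w0 iX) (phi_w0 iY).
- move=> u /WP uW; apply: (kerR_numerator F_inj der DF comm f_homog fs_prime fs_homog e_gt0 fE uW).
  exact: dhomog_is_dhomog.
- move=> [G H] kGH.
  have [mu [h [mu0 hh -> ->]]] := kerR_structure charK0 F_inj F_frac fR der DF
    d_gt0 f_homog fs_prime fs_homog e_gt0 fs_distinct fE all_exact kGH.
  exists (\row_i mu i, DHomog hh).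
    rewrite mem_weight_kernel /weight; apply/eqP; rewrite -[RHS]mu0.
    by apply: eq_bigr => i _; rewrite mxE.
  by congr (_, _); apply: eq_numerator => i; rewrite mxE.
- by apply: contraNneq g0 => /(congr1 snd) /(congr1 val) /= ->.
- move=> u /WP uW p1 p2.
  have [mu0 [c hc]] := numerator_eq0 charK0 F_inj F_frac fR der DF
     fs_prime fs_homog e_gt0 fs_distinct fE uW (dhomog_is_dhomog u.2) p1 p2.
  apply/vlineP; exists c; case: u mu0 hc {uW p1 p2} => mu h /= mu0 hc.
  congr (_, _); last exact: val_inj.
  by apply/rowP => i; rewrite !mxE mulr0.
(* One dimension is lost to the weight condition, one to the line of [w0]. *)
have nE : n%:Z = r%:Z - 2 + ('C(2 + \sum_(i < r) ds i * (e i - 1), 2))%:Z.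
  have := @dim_weight_kernel K r s ds i0 (dsK i0); rewrite -nW addnC -/(excess e ds) -/s (addnC 2%N).
  by move: ('C(s + 2, 2)) => C; lia.
exists n; split=> //; split=> //.
have C_gt0 : (0 < 'C(2 + s, 2))%N by rewrite bin_gt0 leq_addr.
split=> [[f0 [nuf irr_f]]|n0].
- have [_ [nu0 _]] := fs_irr i0.
  (* The cofactor of f_{i0} must be a unit, which excludes a second prime and a second power of
     f_{i0}. *)
  have fE' : f = fs i0 * (fs i0 ^+ (e i0 - 1) * \prod_(k < r | k != i0) fs k ^+ e k).
    by rewrite mulrA -exprS subn1 prednK // fE (bigD1 i0).
  have [|] := irr_f _ _ fE'; first by rewrite (negPf nu0).
  rewrite unitrM => /andP[u1 /unitr_prodP u2].
  have all0 k : k = i0.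
    apply/eqP/negPn/negP => ki; have [_ [nuk _]] := fs_irr k.
    by have := u2 k (mem_index_enum k) ki; rewrite unitrX_pos // (negPf nuk).
  have r1 : r = 1%N.
    apply/eqP; rewrite eqn_leq r0 andbT leqNgt; apply/negP => r1.
    by have := congr1 val (all0 (Ordinal r1)).
  have s0 : s = 0%N.
    rewrite /s /excess big1 // => i _; rewrite (all0 i).
    have [->|ne] := posnP (e i0 - 1); first by rewrite muln0.
    by move: u1; rewrite unitrX_pos // (negPf nu0).
  by move: nE; rewrite -/(excess e ds) -/s s0 r1 (_ : 'C(2 + 0, 2) = 1%N) //; lia.
(* Both terms are at least 1 and their sum is 2. *)
- have [r1 C1] : r = 1%N /\ 'C(2 + s, 2) = 1%N.
    by move: nE (r0) C_gt0; rewrite n0 -/(excess e ds) -/s; move: ('C(2 + s, 2)) => C; lia.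
  have s0 : s = 0%N.
    (* For s >= 1 the binomial coefficient is at least C(3, 2) = 3. *)
    case: (posnP s) => // s0; have : ('C(2 + 1, 2) <= 'C(2 + s, 2))%N.
      by apply: leq_bin2l; rewrite leq_add2l.
    by rewrite C1.
  have all0 k : k = i0.
    by apply: val_inj => /=; case: k => k /=; rewrite r1 ltnS leqn0 => /eqP.
  have e0 : e i0 = 1%N.
    move: s0; rewrite /s /excess (bigD1 i0) //= => /eqP.
    rewrite addn_eq0 muln_eq0 => /andP[/orP[/eqP d0|]]; first by have := ds0 i0; rewrite d0.
    by move=> ei _; have := e_gt0 i0; move: ei; case: (e i0) => [|[|m]]; rewrite ?subn1.
  have -> : f = fs i0.
    rewrite fE (bigD1 i0) //= big1 ?mulr1 ?e0 // => k.
    by rewrite (all0 k) eqxx.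
  exact: fs_irr.
Qed.
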